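(* Let $G=\sum_{k}r_k\delta_{\omega_k}$ be a completely random measure on $\Omega$ with Lévy measure $\rho(ds)\,G_0(d\omega)$, where $\int_0^\infty(1-e^{-s})\rho(ds)<\infty$, and let $X$ be the $G$-mixed Poisson process: $X\mid G$ is a Poisson process with mean measure $G$, i.e. $X=\sum_k n_k\delta_{\omega_k}$ with, given $G$, $n_k\sim\mathrm{Po}(r_k)$ independently. Then $X$ is also a compound Poisson process: with $G$ marginalized out, $X$ is equal in distribution to $$\sum_{k=1}^{l} n_k\,\delta_{\omega_k}(\cdot),\qquad l\sim\mathrm{Po}\left[G_0(\Omega)\int_{0}^\infty(1-e^{-s})\rho(ds)\right],$$ where, independently of $l$ and of each other, the $n_k$ are i.i.d. with $$P(n_k=j)=\frac{\int_{0}^\infty s^j e^{-s}\rho(ds)}{j!\int_{0}^\infty(1-e^{-s})\rho(ds)},\qquad j=1,2,\ldots,$$ and the $\omega_k$ are i.i.d. from $g_0$, where $g_0(d\omega)=G_0(d\omega)/G_0(\Omega)$.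
   Context: $\Omega$ is a complete separable metric space with its Borel $\sigma$-algebra, $G_0$ is a finite measure on $\Omega$ with $G_0(\Omega)>0$, and $\rho$ is a nonzero measure on $(0,\infty)$. The completely random measure $G$ with Lévy measure $\rho(ds)G_0(d\omega)$ is $G=\sum_k r_k\delta_{\omega_k}$, where the (finitely or countably infinitely many) points $(r_k,\omega_k)$ are those of a Poisson random measure on $(0,\infty)\times\Omega$ with intensity $\rho(ds)G_0(d\omega)$; equivalently it has independent values on disjoint Borel sets and $\mathbb{E}[e^{-\lambda G(A)}]=\exp\{-G_0(A)\int_0^\infty(1-e^{-\lambda s})\rho(ds)\}$ for $\lambda\ge 0$. $\mathrm{Po}(\lambda)$ is the Poisson distribution with mean $\lambda$. *)

(* Defs.v *)
From HB Require Import structures.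
From mathcomp Require Import all_boot all_order all_algebra.
From mathcomp Require Import all_classical all_reals all_analysis.
From mathcomp Require Import measurable_realfun.

Set Implicit Arguments.
Unset Strict Implicit.
Unset Printing Implicit Defensive.

Import Order.TTheory GRing.Theory Num.Theory.
Import numFieldNormedType.Exports.

Local Open Scope classical_set_scope.
Local Open Scope ring_scope.

#[short(type="completeMetricType")]
HB.structure Definition CompleteMetric (R : numDomainType) :=
  {T of Metric R T & Complete T}.

Definition separable (T : topologicalType) : Prop :=
  exists2 S : set T, countable S & dense S.

Notation borel T := (g_sigma_algebraType (@open T)).

(* The library's poisson_pmf is not used because at rate 0 it is the constant
   1; the formula below gives the Dirac mass at 0 there (0 ^+ 0 = 1). *)
Definition Po {R : realType} (lam : R) (j : nat) : R :=
  expR (- lam) * lam ^+ j / j`!%:R.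

(* Counts in {0, 1, ..., +oo} are encoded as option nat, None being +oo. *)
Definition ecount {R : realType} (v : option nat) : \bar R :=
  if v is Some j then j%:R%:E else +oo%E.

(* Poisson masses with mean in [0, +oo]; Po(+oo) is the Dirac mass at +oo. *)
Definition ePo {R : realType} (lam : \bar R) (v : option nat) : R :=
  match lam, v with
  | x%:E, Some j => Po x j
  | +oo%E, None => 1
  | _, _ => 0
  end.

Section random_set_functions.
Context {R : realType} {d : measure_display} {T : measurableType d}.

(* The sigma-algebra generated by the evaluations mu |-> mu A, A measurable. *)
Definition eval_sigma : set (set (set T -> \bar R)) :=
  <<s \bigcup_(A in [set A : set T | measurable A])
        preimage_set_system setT (fun mu : set T -> \bar R => mu A)
          measurable >>.

Definition same_law {d1 d2 : measure_display}
    {S1 : measurableType d1} {S2 : measurableType d2}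
    (P1 : probability S1 R) (X1 : S1 -> set T -> \bar R)
    (P2 : probability S2 R) (X2 : S2 -> set T -> \bar R) : Prop :=
  forall C, eval_sigma C -> P1 (X1 @^-1` C) = P2 (X2 @^-1` C).

Context {dS : measure_display} {S : measurableType dS} (P : probability S R).

(* Poisson random measure with intensity nu: the joint mass function over
   disjoint sets is the product of the Po(nu (B i)), i.e. M (B i) ~ Po(nu (B i))
   and the M (B i) are mutually independent. *)
Definition poisson_random_measure (nu : set T -> \bar R)
    (M : S -> set T -> \bar R) : Prop :=
  forall (m : nat) (B : 'I_m -> set T) (v : 'I_m -> option nat),
    (forall i, measurable (B i)) -> trivIset setT B ->
    P [set x | forall i, M x (B i) = ecount (v i)]
    = (\prod_(i < m) ePo (nu (B i)) (v i))%:E.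

(* Conditionally on the sigma-algebra generated by G, whose events are the
   G @^-1` C, X is a Poisson process with mean measure G. *)
Definition mixed_poisson (G X : S -> set T -> \bar R) : Prop :=
  forall (C : set (set T -> \bar R)) (m : nat) (B : 'I_m -> set T)
      (v : 'I_m -> option nat),
    eval_sigma C -> (forall i, measurable (B i)) -> trivIset setT B ->
    P (G @^-1` C `&` [set x | forall i, X x (B i) = ecount (v i)])
    = (\int[P]_(x in G @^-1` C) (\prod_(i < m) ePo (G x (B i)) (v i))%:E)%E.

End random_set_functions.

Section point_processes.
Context {R : realType} {d : measure_display} {T : measurableType d}.
Context {dS : measure_display} {S : measurableType dS} (P : probability S R).

(* The points are the (r k x, w k x) with k in the random index set K x,
   which may be finite or infinite; values at other indices are junk. *)
Section points.
Variables (K : S -> set nat) (r : nat -> {mfun S >-> R})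
  (w : nat -> {mfun S >-> T}).

Definition counting_points (x : S) (B : set (R * T)) : \bar R :=
  (\esum_(k in K x) \d_(r k x, w k x) B)%E.

Definition weighted_points (x : S) (A : set T) : \bar R :=
  (\esum_(k in K x) ((r k x)%:E * \d_(w k x) A))%E.

Definition points_of_crm (rho : {measure set R -> \bar R})
    (G0 : {finite_measure set T -> \bar R}) : Prop :=
  [/\ forall k, measurable [set x | K x k],
      forall x k, K x k -> 0 < r k x &
      poisson_random_measure P (rho \x G0)%E counting_points].

Definition points_sigma : set (set S) :=
  <<s [set E | exists k : nat, exists2 B : set (R * T), measurable B &
        E = [set x | K x k /\ B (r k x, w k x)] ]>>.

Variable n : nat -> {mfun S >-> nat}.

Definition marked_points (x : S) (A : set T) : \bar R :=
  (\esum_(k in K x) ((n k x)%:R%:E * \d_(w k x) A))%E.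

(* Given the points, the marks n k, k in K, are independent, n k ~ Po(r k). *)
Definition poisson_marks : Prop :=
  forall (E : set S) (m : nat) (j : nat -> nat), points_sigma E ->
    P (E `&` [set x | forall k, (k < m)%N -> K x k -> n k x = j k])
    = (\int[P]_(x in E) (\prod_(k < m | `[< K x k >]) Po (r k x) (j k))%:E)%E.

End points.

Definition exponent (rho : {measure set R -> \bar R}) : \bar R :=
  (\int[rho]_(s in `]0%R, +oo[) (1 - expR (- s))%:E)%E.

Definition jump_pmf (rho : {measure set R -> \bar R}) (j : nat) : R :=
  fine (\int[rho]_(s in `]0%R, +oo[) (s ^+ j * expR (- s))%:E)%E
  / (j`!%:R * fine (exponent rho)).

Definition compound (l : {mfun S >-> nat}) (n : nat -> {mfun S >-> nat})
    (w : nat -> {mfun S >-> T}) (x : S) (A : set T) : \bar R :=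
  (\sum_(k < l x) ((n k x)%:R%:E * \d_(w k x) A))%E.

(* The last item is the mutual independence of l, the n k and the w k: taking
   some of the sets L, J k, B k to be full restricts it to any finite
   subfamily. *)
Definition compound_data (rho : {measure set R -> \bar R})
    (G0 : {finite_measure set T -> \bar R}) (l : {mfun S >-> nat})
    (n : nat -> {mfun S >-> nat}) (w : nat -> {mfun S >-> T}) : Prop :=
  [/\ forall j, P (l @^-1` [set j])
        = (Po (fine (G0 setT * exponent rho)%E) j)%:E,
      forall k j, (0 < j)%N -> P (n k @^-1` [set j]) = (jump_pmf rho j)%:E,
      forall k B, measurable B ->
        P (w k @^-1` B) = (G0 B * (fine (G0 setT))^-1%:E)%E &
      forall (m : nat) (L : set nat) (J : nat -> set nat) (B : nat -> set T),
        (forall k, measurable (B k)) ->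
        P (l @^-1` L `&`
           [set x | forall k, (k < m)%N -> J k (n k x) /\ B k (w k x)])
        = (P (l @^-1` L) *
           \prod_(k < m) (P (n k @^-1` J k) * P (w k @^-1` B k)))%E].

End point_processes.

(* Main.v *)
Require Import Defs.
From HB Require Import structures.
From mathcomp Require Import all_boot all_order all_algebra.
From mathcomp Require Import all_classical all_reals all_analysis.
From mathcomp Require Import measurable_realfun.
From mathcomp Require Import ring.

Set Implicit Arguments.
Unset Strict Implicit.
Unset Printing Implicit Defensive.

Import Order.TTheory GRing.Theory Num.Theory.
Import numFieldNormedType.Exports.

Local Open Scope classical_set_scope.
Local Open Scope ring_scope.

(* The law of a finitely additive random set function with values in the
   natural numbers is determined by the joint generating functions
   E prod_t z_t ^ (X B_t) over finite measurable partitions (B_t): a generating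
   function determines the mass function of the counts of the cells, and these
   cylinder events form a pi-system.  A partition is encoded by a labelling
   tau : T -> nat with finitely many values, B_t being the fibre of t.

   All three processes have the generating function
     exp (- sum_t G0 B_t * psi (1 - z_t)),  psi c = int (1 - e^(- c s)) rho(ds).
   Given G, or given its points, the conditional generating function of a
   Po(G B_t) variable is exp (- (1 - z_t) G B_t), which leaves the Laplace
   functional of the Poisson random measure of points at
   f (s, y) = (1 - z_(tau y)) s.  For the compound process, the generating
   function of one labelled jump is
     phi = sum_t (G0 B_t / G0 T) * (psi 1 - psi (1 - z_t)) / psi 1,
   and E phi ^ l = exp (- (1 - phi) * G0 T * psi 1). *)

(** * Sums over countable types and mixtures *)

(** Infinite values shape the argument. Counts and masses live in [0, +oo], and nothing says
    beforehand that a mixed Poisson process or a sum of marks is finite on a given set. Generating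
    functions are therefore taken at 0 < z < 1, with z ^ oo = 0: they see exactly the outcomes in
    which the counts of all cells are finite. Finiteness is evident for the compound process alone,
    so equality of generating functions first gives an inequality between cylinder probabilities;
    the inequality for the complementary cylinder turns it into an equality.

    Conditional laws come as identities between integrals of mass functions. They are extended by
    linearity to products of functions of the counts, with random weights, and no conditional
    expectation has to be constructed.

    Labels make a whole partition into one test function: every point has exactly one label, whence
    sum_t c_t G(B_t) = sum_k c_(tau w_k) r_k. *)

Section countable_sums.
Local Open Scope ereal_scope.
Context {R : realType} {I : countType}.

(** Codes of no element contribute 0, so results on series over the naturals carry over to any
    countable type, in particular to pairs and options. *)
Lemma esum_countE (F : I -> \bar R) : (forall i, 0 <= F i) ->
  \esum_(i in [set: I]) F i = \sum_(n <oo) oapp F 0 (pickle_inv n).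
Proof.
move=> F0; rewrite nneseries_esumT; last by move=> n; case: pickle_inv.
rewrite (_ : \esum_(i in [set: nat]) _ =
    \esum_(i in pickle @` [set: I]) oapp F 0 (pickle_inv i)).
  rewrite esum_image; last by move=> i j _ _; exact: (pcan_inj pickleK_inv).
  by apply: eq_esum => i _; rewrite pickleK_inv.
rewrite [RHS]esum_mkcond; apply: eq_esum => n _.
case: ifPn => // /negP nI; case E: (pickle_inv n) => [i|//].
by exfalso; apply: nI; rewrite inE; exists i => //; have := @pickle_invK I n; rewrite E.
Qed.

Lemma esumZl (a : \bar R) (F : I -> \bar R) : 0 <= a -> (forall i, 0 <= F i) ->
  \esum_(i in [set: I]) (a * F i) = a * \esum_(i in [set: I]) F i.
Proof.
move=> a0 F0; have aF0 i : 0 <= a * F i by exact: mule_ge0.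
case: a a0 aF0 => [a| |//] a0 aF0.
  rewrite !esum_countE// -nneseriesZl//; last by move=> n _; case: pickle_inv.
  by apply: eq_eseriesr => n _; case: pickle_inv => //=; rewrite mule0.
have [F00|/existsNP[i /eqP Fi]] := pselect (forall i, F i = 0).
  by rewrite !esum1 ?mule0// => i _; rewrite F00 ?mule0.
have Fi0 : 0 < F i by rewrite lt0e Fi F0.
have le_esum1 (G : I -> \bar R) : (forall i, 0 <= G i) ->
    G i <= \esum_(j in [set: I]) G j.
  move=> G0; rewrite -[leLHS](esum_set1 (t := i))//.
  rewrite esum_mkcond; apply: le_esum => j _.
  by case: ifPn.
have sF0 : 0 < \esum_(j in [set: I]) F j by rewrite (lt_le_trans Fi0)// le_esum1.
by rewrite gt0_mulye//; apply/eqP; rewrite -leye_eq;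
  rewrite (le_trans _ (le_esum1 _ aF0))// gt0_mulye.
Qed.

Context {d} {T : measurableType d} (mu : {measure set T -> \bar R}).
Variable f : I -> T -> \bar R.
Hypothesis mf : forall i, measurable_fun setT (f i).
Hypothesis f0 : forall i x, 0 <= f i x.

Lemma measurable_fun_esum :
  measurable_fun setT (fun x => \esum_(i in [set: I]) f i x).
Proof.
rewrite (_ : (fun x => _) = fun x =>
    \sum_(n <oo | n \in xpredT) oapp (f^~ x) 0 (pickle_inv n)).
  apply: ge0_emeasurable_sum => [n x _ _|n _]; first by case: pickle_inv => /=.
  by case: pickle_inv => //= i; exact: mf.
by apply/funext => x; rewrite esum_countE.
Qed.

Lemma ge0_integral_esum : \int[mu]_x (\esum_(i in [set: I]) f i x) =
  \esum_(i in [set: I]) \int[mu]_x f i x.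
Proof.
rewrite [RHS]esum_countE; last by move=> i; exact: integral_ge0.
under eq_integral do rewrite esum_countE//.
rewrite integral_nneseries//=; last 2 first.
- by move=> n; case: pickle_inv => //= i; exact: mf.
- by move=> n x _; case: pickle_inv => /=.
by apply: eq_eseriesr => n _; case: pickle_inv => //=; rewrite integral0.
Qed.

End countable_sums.

Section mixtures.
Local Open Scope ereal_scope.
Context {R : realType} {d} {S : measurableType d} (P : {measure set S -> \bar R}).

Lemma emeasurable_prod m (h : nat -> S -> \bar R) :
  (forall k, measurable_fun setT (h k)) ->
  measurable_fun setT (fun x => \prod_(k < m) h k x).
Proof.
move=> mh; elim: m => [|m IH].
  by under eq_fun do rewrite big_ord0; exact: measurable_cst.
by under eq_fun do rewrite big_ord_recr; exact: emeasurable_funM.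
Qed.

Lemma esum_delta (I : countType) (g : I -> \bar R) (o : option I) :
  (forall i, 0 <= g i) ->
  \esum_(i in [set: I]) (g i * (o == Some i)%:R%:E) = oapp g 0 o.
Proof.
move=> g0; case: o => [i|/=]; last by rewrite esum1// => i _; rewrite mule0.
rewrite -[RHS](esum_set1 (t := i))// [RHS]esum_mkcond; apply: eq_esum => j _.
rewrite -[Some i == Some j]/(i == j) (eq_sym i) in_set1.
by case: (j == i); rewrite ?mule1 ?mule0.
Qed.

Lemma measurable_fun_option_eq (I : eqType) (o : S -> option I) (i : I) :
  measurable [set x | o x = Some i] ->
  measurable_fun setT (fun x => (o x == Some i)%:R%:E : \bar R).
Proof.
move=> mo; apply/measurable_EFinP.
rewrite (_ : (fun x => _) = \1_[set x | o x = Some i]).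
  exact: measurable_indic.
by apply/funext => x; rewrite indicE; congr (nat_of_bool _)%:R;
  apply/eqP/idP; rewrite inE.
Qed.

Lemma measurable_fun_oapp (I : countType) (g : I -> \bar R) (o : S -> option I) :
  (forall i, 0 <= g i) -> (forall i, measurable [set x | o x = Some i]) ->
  measurable_fun setT (fun x => oapp g 0 (o x)).
Proof.
move=> g0 mo; rewrite (_ : (fun x => _) = fun x =>
    \esum_(i in [set: I]) (g i * (o x == Some i)%:R%:E)).
  apply: measurable_fun_esum => [i|i x]; last by rewrite mule_ge0.
  by apply: measurable_funeM; exact: measurable_fun_option_eq.
by apply/funext => x; rewrite esum_delta.
Qed.

(** Tonelli's theorem, after [g] at the value of [o] is written as a sum of indicators of the
    values; the outcome [None] contributes 0. *)
Lemma integral_oapp (I : countType) (V : S -> \bar R) (g : I -> \bar R)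
    (o : S -> option I) :
  measurable_fun setT V -> (forall x, 0 <= V x) -> (forall i, 0 <= g i) ->
  (forall i, measurable [set x | o x = Some i]) ->
  \int[P]_x (V x * oapp g 0 (o x))
  = \esum_(i in [set: I]) (g i * \int[P]_x (V x * (o x == Some i)%:R%:E)).
Proof.
move=> mV V0 g0 mo.
have mVo i : measurable_fun setT (fun x => V x * (o x == Some i)%:R%:E).
  by apply: emeasurable_funM => //; exact: measurable_fun_option_eq.
transitivity (\esum_(i in [set: I])
    \int[P]_x (g i * (V x * (o x == Some i)%:R%:E))).
  rewrite -ge0_integral_esum//; last 2 first.
  - by move=> i; exact: measurable_funeM.
  - by move=> i x; rewrite !mule_ge0.
  apply: eq_integral => x _; rewrite -esum_delta// -esumZl//; last first.
    by move=> i; rewrite mule_ge0.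
  by apply: eq_esum => i _; rewrite muleCA.
apply: eq_esum => i _; rewrite ge0_integralZl//.
by move=> x _; rewrite mule_ge0.
Qed.

(* By linearity an identity for the joint mass function extends to products of
   functions of the N k, even if W and W' depend on x: the induction on m moves
   the last factor into the weights W and W'.  N k x = None is a junk outcome,
   on which the product is 0. *)
Lemma integral_prod_mixture (I : countType) (i0 : I) m (W W' : S -> \bar R)
    (N : nat -> S -> option I) (q : nat -> I -> S -> \bar R)
    (g : nat -> I -> \bar R) :
  measurable_fun setT W -> measurable_fun setT W' ->
  (forall x, 0 <= W x) -> (forall x, 0 <= W' x) ->
  (forall k i, measurable [set x | N k x = Some i]) ->
  (forall k i, measurable_fun setT (q k i)) ->
  (forall k i x, 0 <= q k i x) -> (forall k i, 0 <= g k i) ->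
  (forall c : nat -> I,
    \int[P]_x (W x * \prod_(k < m) (N k x == Some (c k))%:R%:E)
    = \int[P]_x (W' x * \prod_(k < m) q k (c k) x)) ->
  \int[P]_x (W x * \prod_(k < m) oapp (g k) 0 (N k x))
  = \int[P]_x (W' x * \prod_(k < m) \esum_(i in [set: I]) (g k i * q k i x)).
Proof.
move=> mW mW' W0 W'0 mN mq q0 g0.
have mD k i : measurable_fun setT (fun x => (N k x == Some i)%:R%:E : \bar R).
  exact: measurable_fun_option_eq.
have mG k : measurable_fun setT (fun x => oapp (g k) 0 (N k x)).
  exact: measurable_fun_oapp.
have mQ k : measurable_fun setT (fun x => \esum_(i in [set: I]) (g k i * q k i x)).
  apply: measurable_fun_esum => [i|i x]; last by rewrite mule_ge0.
  exact: measurable_funeM.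
have G0 k x : 0 <= oapp (g k) 0 (N k x) by case: (N k x) => /=.
have Q0 k x : 0 <= \esum_(i in [set: I]) (g k i * q k i x).
  by apply: esum_ge0 => i _; rewrite mule_ge0.
have mpG p x : 0 <= \prod_(k < p) oapp (g k) 0 (N k x) by exact: prode_ge0.
have mpQ p x : 0 <= \prod_(k < p) \esum_(i in [set: I]) (g k i * q k i x).
  exact: prode_ge0.
elim: m => [|m IH] in W W' mW mW' W0 W'0 *.
  move=> /(_ (fun=> i0)) H.
  transitivity (\int[P]_x (W x * \prod_(k < 0) (N k x == Some i0)%:R%:E)).
    by apply: eq_integral => x _; rewrite !big_ord0.
  by rewrite H; apply: eq_integral => x _; rewrite !big_ord0.
move=> H.
have step i : \int[P]_x (W x * (N m x == Some i)%:R%:E *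
      \prod_(k < m) oapp (g k) 0 (N k x)) =
    \int[P]_x (W' x * q m i x *
      \prod_(k < m) \esum_(i in [set: I]) (g k i * q k i x)).
  apply: IH => //; [exact: emeasurable_funM|exact: emeasurable_funM| | |].
  - by move=> x; rewrite mule_ge0.
  - by move=> x; rewrite mule_ge0.
  move=> c; pose c' k := if (k < m)%N then c k else i.
  transitivity (\int[P]_x (W x * \prod_(k < m.+1) (N k x == Some (c' k))%:R%:E)).
    apply: eq_integral => x _; rewrite big_ord_recr/= /c' ltnn -muleA.
    congr (_ * _); rewrite muleC; congr (_ * _).
    by apply: eq_bigr => k _; rewrite ltn_ord.
  rewrite H; apply: eq_integral => x _; rewrite big_ord_recr/= /c' ltnn -muleA.
  congr (_ * _); rewrite muleC; congr (_ * _).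
  by apply: eq_bigr => k _; rewrite ltn_ord.
transitivity (\esum_(i in [set: I]) (g m i *
    \int[P]_x (W x * (N m x == Some i)%:R%:E *
      \prod_(k < m) oapp (g k) 0 (N k x)))).
  under eq_integral do rewrite big_ord_recr/= muleA.
  rewrite integral_oapp//; last 2 first.
  - by apply: emeasurable_funM => //; exact: (emeasurable_prod m mG).
  - by move=> x; rewrite mule_ge0// mpG.
  apply: eq_esum => i _; congr (_ * _); apply: eq_integral => x _.
  by rewrite muleAC.
transitivity (\esum_(i in [set: I]) (g m i *
    \int[P]_x (W' x * q m i x *
      \prod_(k < m) \esum_(i in [set: I]) (g k i * q k i x)))).
  by apply: eq_esum => i _; rewrite step.
transitivity (\esum_(i in [set: I]) \int[P]_x (g m i *
    (W' x * q m i x * \prod_(k < m) \esum_(i in [set: I]) (g k i * q k i x)))).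
  apply: eq_esum => i _; rewrite ge0_integralZl//.
  - by apply: emeasurable_funM; [exact: emeasurable_funM|exact: (emeasurable_prod m mQ)].
  - by move=> x _; rewrite !mule_ge0.
rewrite -ge0_integral_esum//; last 2 first.
+ move=> i; apply: measurable_funeM; apply: emeasurable_funM.
    exact: emeasurable_funM.
  exact: (emeasurable_prod m mQ).
+ by move=> i x; rewrite !mule_ge0.
apply: eq_integral => x _; rewrite big_ord_recr/= muleA -esumZl ?mule_ge0 ?mpQ//.
  by apply: eq_esum => i _; rewrite [RHS]muleCA [in RHS]muleAC.
by move=> i; rewrite mule_ge0.
Qed.
End mixtures.

(** * Generating functions *)

Section generating_functions.
Local Open Scope ereal_scope.
Context {R : realType}.

Lemma nneseries_recl1 (f : nat -> \bar R) : (forall i, 0 <= f i) ->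
  \sum_(i <oo) f i = f 0%N + \sum_(i <oo) f i.+1.
Proof.
move=> f0; rewrite (nneseries_split 0 1)// big_nat1 add0n; congr (_ + _).
by rewrite -nneseries_addn//; apply: eq_eseriesr => i _; rewrite addn1.
Qed.

(** As z tends to 0 a generating function tends to its constant term, the rest being at most z * C.
    Once the constant terms agree, they are subtracted and the remainder is divided by z > 0. *)
Lemma gen_fun_tail (a b : nat -> \bar R) (C : R) :
  (forall j, 0 <= a j) -> (forall j, 0 <= b j) ->
  \sum_(j <oo) a j <= C%:E -> \sum_(j <oo) b j <= C%:E ->
  (forall z : R, (0 < z < 1)%R ->
    \sum_(j <oo) ((z ^+ j)%:E * a j) = \sum_(j <oo) ((z ^+ j)%:E * b j)) ->
  a 0%N = b 0%N /\ forall z : R, (0 < z < 1)%R ->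
    \sum_(j <oo) ((z ^+ j)%:E * a j.+1) = \sum_(j <oo) ((z ^+ j)%:E * b j.+1).
Proof.
move=> a0 b0 aC bC ab.
have zX0 (u : nat -> \bar R) (z : R) i j : (forall j, 0 <= u j) ->
    (0 < z < 1)%R -> 0 <= (z ^+ i)%:E * u j.
  by move=> u0 /andP[z0 _]; rewrite mule_ge0// lee_fin exprn_ge0// ltW.
have split (u : nat -> \bar R) (z : R) : (forall j, 0 <= u j) -> (0 < z < 1)%R ->
    \sum_(j <oo) ((z ^+ j)%:E * u j) =
      u 0%N + z%:E * \sum_(j <oo) ((z ^+ j)%:E * u j.+1).
  move=> u0 z01; rewrite nneseries_recl1; last by move=> j; exact: zX0.
  rewrite expr0 mul1e; congr (_ + _).
  rewrite -nneseriesZl; last by move=> j _; exact: zX0.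
  by apply: eq_eseriesr => j _; rewrite exprS EFinM muleA.
have sumC (u : nat -> \bar R) : (forall j, 0 <= u j) ->
    \sum_(j <oo) u j <= C%:E -> u 0%N <= C%:E /\ \sum_(j <oo) u j.+1 <= C%:E.
  move=> u0 uC; rewrite nneseries_recl1// in uC; split.
    by apply: le_trans uC; rewrite leeDl// nneseries_ge0.
  by apply: le_trans uC; rewrite leeDr.
have tailC (u : nat -> \bar R) (z : R) : (forall j, 0 <= u j) ->
    \sum_(j <oo) u j <= C%:E -> (0 < z < 1)%R ->
    0 <= \sum_(j <oo) ((z ^+ j)%:E * u j.+1) <= C%:E.
  move=> u0 uC z01; apply/andP; split.
    by apply: nneseries_ge0 => j _ _; exact: zX0.
  have [_] := sumC _ u0 uC; apply: le_trans; apply: lee_nneseries => j _.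
    by move=> _; exact: zX0.
  rewrite -[leRHS]mul1e lee_wpmul2r// lee_fin; move/andP: z01 => [z0 z1].
  by rewrite exprn_ile1// ltW.
have fin0 (u : nat -> \bar R) : (forall j, 0 <= u j) ->
    \sum_(j <oo) u j <= C%:E -> u 0%N \is a fin_num.
  move=> u0 uC; rewrite ge0_fin_numE//; have [h _] := sumC _ u0 uC.
  by rewrite (le_lt_trans h)// ltry.
have C0 : (0 <= C)%R by rewrite -lee_fin (le_trans _ aC)// nneseries_ge0.
have le00 (u v : nat -> \bar R) : (forall j, 0 <= u j) -> (forall j, 0 <= v j) ->
    \sum_(j <oo) u j <= C%:E -> \sum_(j <oo) v j <= C%:E ->
    (forall z : R, (0 < z < 1)%R ->
    \sum_(j <oo) ((z ^+ j)%:E * u j) = \sum_(j <oo) ((z ^+ j)%:E * v j)) ->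
    u 0%N <= v 0%N.
  move=> u0 v0 uC vC uv; rewrite leNgt; apply/negP.
  have := fin0 _ u0 uC; have := fin0 _ v0 vC.
  case Ev : (v 0%N) => [v_|//|//] _; case Eu : (u 0%N) => [u_|//|//] _.
  rewrite lte_fin => vu.
  pose e := (u_ - v_)%R; have e0 : (0 < e)%R by rewrite subr_gt0.
  (* Chosen so that z < 1 and z * C < e, against u_ <= v_ + z * C. *)
  pose z := (e / (e + C + 1))%R.
  have D0 : (0 < e + C + 1)%R by rewrite addr_gt0// ltr_pwDl.
  have z01 : (0 < z < 1)%R.
    by rewrite divr_gt0//= ltr_pdivrMr// mul1r -addrA ltrDl ltr_wpDl.
  have z0 : (0 <= z)%R by case/andP: z01 => /ltW.
  have /andP[s0 _] := tailC _ _ u0 uC z01.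
  have /andP[t0 tC] := tailC _ _ v0 vC z01.
  have := uv _ z01; rewrite (split u)// (split v)// => E.
  have : u_%:E <= v_%:E + z%:E * C%:E.
    rewrite -Eu -Ev (@le_trans _ _ (u 0%N + z%:E * \sum_(j <oo) ((z ^+ j)%:E * u j.+1)))//.
      by rewrite leeDl// mule_ge0.
    by rewrite E leeD2l// lee_wpmul2l.
  rewrite -EFinM -EFinD lee_fin -lerBlDl -/e leNgt => /negP; apply.
  rewrite /z mulrAC ltr_pdivrMr// ltr_pM2l// -addrA addrCA ltrDl.
  by rewrite addr_gt0.
have ab0 : a 0%N = b 0%N.
  apply/eqP; rewrite eq_le le00//=; apply: le00 => // z z01; exact/esym/ab.
split=> // z z01; have := ab _ z01; rewrite (split a)// (split b)// ab0.
have /andP[ta0 taC] := tailC _ _ a0 aC z01.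
have /andP[tb0 tbC] := tailC _ _ b0 bC z01.
move/(congr1 (fun x => x - b 0%N)).
rewrite ![b 0%N + _]addeC !addeK//; last 2 first.
  by rewrite fin0.
  by rewrite fin0.
have z0 : (0 < z)%R by case/andP: z01.
move/(congr1 (fun x => (z^-1)%:E * x)); rewrite !muleA -!EFinM mulVf ?gt_eqF//.
by rewrite !mul1e.
Qed.

(** The coefficients are peeled off one at a time; the induction ranges over all pairs of sequences,
    and the bound C passes to the shifted ones. *)
Lemma gen_fun_inj (a b : nat -> \bar R) (C : R) :
  (forall j, 0 <= a j) -> (forall j, 0 <= b j) ->
  \sum_(j <oo) a j <= C%:E -> \sum_(j <oo) b j <= C%:E ->
  (forall z : R, (0 < z < 1)%R ->
    \sum_(j <oo) ((z ^+ j)%:E * a j) = \sum_(j <oo) ((z ^+ j)%:E * b j)) ->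
  forall j, a j = b j.
Proof.
move=> + + + + + j; elim: j a b => [|j IH] a b a0 b0 aC bC ab.
  by have [] := gen_fun_tail a0 b0 aC bC ab.
have tail (u : nat -> \bar R) : (forall j, 0 <= u j) ->
    \sum_(j <oo) u j <= C%:E -> \sum_(j <oo) u j.+1 <= C%:E.
  by move=> u0; apply: le_trans; rewrite [leRHS]nneseries_recl1// leeDr.
have [_ ab1] := gen_fun_tail a0 b0 aC bC ab.
by apply: (IH (a \o S) (b \o S)) => //=; exact: tail.
Qed.

(* z ^ o, where None stands for an infinite exponent (0 <= z < 1). *)
Definition pow (z : R) (o : option nat) : \bar R :=
  oapp (fun j => (z ^+ j)%:E) 0 o.

Lemma pow_ge0 z o : (0 <= z)%R -> 0 <= pow z o.
Proof. by move=> z0; case: o => //= j; rewrite lee_fin exprn_ge0. Qed.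

Lemma pow_le1 z o : (0 <= z <= 1)%R -> pow z o <= 1.
Proof.
by move=> /andP[z0 z1]; case: o => [j|]/=; rewrite ?lee_fin ?exprn_ile1.
Qed.

(** One variable is inverted at a time. The indicator of the value of the last count is absorbed
    into the weight, where the induction hypothesis applies; what it requires is the one-variable
    result in z m, the other variables being fixed. Weights in [0, 1] provide its bound, C = 1. *)
Lemma joint_gen_fun_inj d1 d2 (S1 : measurableType d1) (S2 : measurableType d2)
    (P1 : probability S1 R) (P2 : probability S2 R) m
    (W1 : S1 -> \bar R) (W2 : S2 -> \bar R)
    (N1 : nat -> S1 -> option nat) (N2 : nat -> S2 -> option nat) :
  measurable_fun setT W1 -> measurable_fun setT W2 ->
  (forall x, 0 <= W1 x <= 1) -> (forall x, 0 <= W2 x <= 1) ->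
  (forall k j, measurable [set x | N1 k x = Some j]) ->
  (forall k j, measurable [set x | N2 k x = Some j]) ->
  (forall z : nat -> R, (forall k, 0 < z k < 1)%R ->
    \int[P1]_x (W1 x * \prod_(k < m) pow (z k) (N1 k x)) =
    \int[P2]_x (W2 x * \prod_(k < m) pow (z k) (N2 k x))) ->
  forall c : nat -> nat,
    \int[P1]_x (W1 x * \prod_(k < m) (N1 k x == Some (c k))%:R%:E) =
    \int[P2]_x (W2 x * \prod_(k < m) (N2 k x == Some (c k))%:R%:E).
Proof.
move=> + + + + mN1 mN2.
elim: m => [|m IH] in W1 W2 *; move=> mW1 mW2 W1_01 W2_01 H c.
  (* The empty product does not depend on z, but the hypothesis needs some point of the interval (0,
     1). *)
  transitivity (\int[P1]_x (W1 x * \prod_(k < 0) pow (1 / 2)%R (N1 k x))).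
    by apply: eq_integral => x _; rewrite !big_ord0.
  rewrite (H (fun=> (1 / 2)%R)).
    by apply: eq_integral => x _; rewrite !big_ord0.
  by move=> _; rewrite divr_gt0//= ltr_pdivrMr// mul1r ltr1n.
under eq_integral do rewrite big_ord_recr/= muleCA muleC.
under [RHS]eq_integral do rewrite big_ord_recr/= muleCA muleC.
have W01 dd (S : measurableType dd) (W : S -> \bar R) (N : S -> option nat) j x :
    0 <= W x <= 1 -> 0 <= W x * (N x == Some j)%:R%:E <= 1.
  by case: eqP => _; rewrite ?mule1// mule0 lexx lee01.
apply: (IH (fun x => W1 x * (N1 m x == Some (c m))%:R%:E)
  (fun x => W2 x * (N2 m x == Some (c m))%:R%:E)) => [| | | |z z01].
- by apply: emeasurable_funM => //; exact: measurable_fun_option_eq.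
- by apply: emeasurable_funM => //; exact: measurable_fun_option_eq.
- by move=> x; exact: W01.
- by move=> x; exact: W01.
have z0 k : (0 <= z k)%R by case/andP: (z01 k) => /ltW.
have mpow dd (S : measurableType dd) (N : nat -> S -> option nat) k :
    (forall k j, measurable [set x | N k x = Some j]) ->
    measurable_fun setT (fun x => pow (z k) (N k x)).
  by move=> mN; apply: measurable_fun_oapp => // j; rewrite lee_fin exprn_ge0.
(* With z fixed, the integrals over the events [N m x = Some j] form a sequence in j of total at
   most 1, whose generating function at t is the joint one with t in place of z m. *)
have VP dd (S : measurableType dd) (P : probability S R) (W : S -> \bar R)
    (N : nat -> S -> option nat) : measurable_fun setT W ->
    (forall x, 0 <= W x <= 1) ->
    (forall k j, measurable [set x | N k x = Some j]) ->
    [/\ (forall j, 0 <= \int[P]_x (W x * (\prod_(k < m) pow (z k) (N k x)) *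
            (N m x == Some j)%:R%:E)),
        \sum_(j <oo) \int[P]_x (W x * (\prod_(k < m) pow (z k) (N k x)) *
            (N m x == Some j)%:R%:E) <= 1%:E &
        forall t : R, (0 < t < 1)%R ->
        \sum_(j <oo) ((t ^+ j)%:E * \int[P]_x (W x * (\prod_(k < m) pow (z k) (N k x)) *
            (N m x == Some j)%:R%:E)) =
        \int[P]_x (W x * \prod_(k < m.+1)
          pow (if (k < m)%N then z k else t) (N k x))].
  move=> mW W01' mN.
  pose V x := W x * (\prod_(k < m) pow (z k) (N k x)).
  have mV : measurable_fun setT V.
    apply: emeasurable_funM => //; apply: (@emeasurable_prod _ _ _ m (fun k x => pow (z k) (N k x))) => k.
    exact: mpow.
  have V01 x : 0 <= V x <= 1.
    have /andP[w0 w1] := W01' x.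
    have p0 p : 0 <= \prod_(k < p) pow (z k) (N k x).
      by apply: prode_ge0 => k _; exact: pow_ge0.
    rewrite /V mule_ge0 ?p0//= (le_trans (lee_wpmul2r (p0 m) w1))// mul1e.
    elim: (m) => [|p IHp]; first by rewrite big_ord0.
    rewrite big_ord_recr/= -[leRHS]mule1 lee_pmul ?p0 ?pow_ge0//.
    by rewrite pow_le1// z0/= ltW//; case/andP: (z01 p).
  have V0 x : 0 <= V x by case/andP: (V01 x).
  have I0 j : 0 <= \int[P]_x (V x * (N m x == Some j)%:R%:E).
    by apply: integral_ge0 => x _; rewrite mule_ge0.
  split => // [|t /andP[t0 t1]].
    have -> : \sum_(j <oo) \int[P]_x (V x * (N m x == Some j)%:R%:E) =
        \int[P]_x (V x * oapp (fun=> 1) 0 (N m x)).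
      rewrite integral_oapp// -nneseries_esumT//.
        by apply: eq_eseriesr => j _; rewrite mul1e.
      by move=> j; rewrite mul1e.
    rewrite -[leRHS](@probability_setT _ _ _ P) -[leRHS]mul1e -integral_cst//.
    apply: ge0_le_integral => //.
    - by move=> x _; rewrite mule_ge0//; case: (N m x).
    - by apply: emeasurable_funM => //; exact: measurable_fun_oapp.
    - move=> x _; rewrite -[leRHS]mul1e lee_pmul//.
      + by case: (N m x).
      + by case/andP: (V01 x).
      + by case: (N m x).
  have t0' : (0 <= t)%R by rewrite ltW.
  rewrite nneseries_esumT; last by move=> j; rewrite mule_ge0// lee_fin exprn_ge0.
  rewrite -integral_oapp//; last by move=> j; rewrite lee_fin exprn_ge0.
  apply: eq_integral => x _; rewrite big_ord_recr/= ltnn muleA; congr (_ * _ * _).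
  by apply: eq_bigr => k _; rewrite ltn_ord.
have [a0 a1 aE] := VP _ _ P1 W1 N1 mW1 W1_01 mN1.
have [b0 b1 bE] := VP _ _ P2 W2 N2 mW2 W2_01 mN2.
have z01' t k : (0 < t < 1)%R -> (0 < (if (k < m)%N then z k else t) < 1)%R.
  by case: ifP.
have ab := gen_fun_inj a0 b0 a1 b1 (fun t t01 =>
  etrans (aE t t01) (etrans (H _ (fun k => z01' t k t01)) (esym (bE t t01)))) (c m).
under eq_integral do rewrite muleAC.
by rewrite ab; apply: eq_integral => x _; rewrite muleAC.
Qed.

End generating_functions.

(** * Laws of random set functions *)

Section counts.
Local Open Scope ereal_scope.
Context {R : realType}.

(* None if x is not a natural number; for the counts considered below this means
   x = +oo. *)
Definition to_count (x : \bar R) : option nat :=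
  if pselect (exists j : nat, x = j%:R%:E) is left h then Some (projT1 (cid h))
  else None.

Lemma to_countP (x : \bar R) j : to_count x = Some j <-> x = j%:R%:E.
Proof.
rewrite /to_count; case: pselect => [h|h]; split => //.
- by case: (cid h) => /= i -> [->].
- case: (cid h) => /= i -> [] /eqP; rewrite eqr_nat => /eqP ->.
  by [].
- by move=> xj; exfalso; apply: h; exists j.
Qed.

Lemma to_countK j : to_count j%:R%:E = Some j.
Proof. exact/to_countP. Qed.

Lemma measurable_to_count d (S : measurableType d) (f : S -> \bar R) j :
  measurable_fun setT f -> measurable [set x | to_count (f x) = Some j].
Proof.
move=> mf; rewrite (_ : [set x | _] = f @^-1` [set j%:R%:E]).
  by rewrite -[X in measurable X]setTI; exact: mf.
by apply/seteqP; split => x /to_countP.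
Qed.

Lemma prod_delta (I : eqType) m (N : nat -> option I) (c : nat -> I) :
  \prod_(k < m) (N k == Some (c k))%:R%:E =
  (`[< forall k, (k < m)%N -> N k = Some (c k) >])%:R%:E :> \bar R.
Proof.
elim: m => [|m IH]; first by rewrite big_ord0 (_ : `[< _ >])//; apply/asboolP.
rewrite big_ord_recr/= IH -EFinM -natrM mulnb; congr ((nat_of_bool _)%:R)%:E.
apply/andP/asboolP => [[/asboolP h /eqP e] k|h].
  by rewrite ltnS leq_eqVlt => /orP[/eqP ->|/h].
by split; [apply/asboolP => k km; apply: h; exact: ltnW|apply/eqP/h].
Qed.

Lemma measurable_forall_ltn d (S : measurableType d) m (F : nat -> set S) :
  (forall k, measurable (F k)) ->
  measurable [set x | forall k, (k < m)%N -> F k x].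
Proof.
move=> mF; rewrite (_ : [set x | _] = \bigcap_(k in [set k | (k < m)%N]) F k).
  exact: bigcap_measurableType.
by apply/seteqP; split => x h k; exact: h.
Qed.

(** Brings the probability of prescribed outcomes into the form taken by [integral_prod_mixture] and
    [joint_gen_fun_inj]. *)
Lemma integral_prod_delta (I : eqType) d (S : measurableType d)
    (P : {measure set S -> \bar R}) m (E : set S) (N : nat -> S -> option I)
    (c : nat -> I) :
  measurable E -> (forall k i, measurable [set x | N k x = Some i]) ->
  \int[P]_x ((\1_E x)%:E * \prod_(k < m) (N k x == Some (c k))%:R%:E) =
  P (E `&` [set x | forall k, (k < m)%N -> N k x = Some (c k)]).
Proof.
move=> mE mN.
have mF : measurable [set x | forall k, (k < m)%N -> N k x = Some (c k)].
  exact: (@measurable_forall_ltn _ _ m (fun k => [set x | N k x = Some (c k)])).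
rewrite -[X in _ = P X]setIT -integral_indic//; last exact: measurableI.
apply: eq_integral => x _; rewrite (prod_delta m (N^~ x)) -EFinM indicI; congr _%:E.
Qed.

End counts.

(** * Finite partitions and their labellings *)

Section law_from_generating_functions.
Local Open Scope ereal_scope.
Context {R : realType} {d} {T : measurableType d}.

Definition additive_set_fun (mu : set T -> \bar R) :=
  mu set0 = 0 /\ forall A B, measurable A -> measurable B -> A `&` B = set0 ->
    mu (A `|` B) = mu A + mu B.

Definition labelling M (tau : T -> nat) :=
  (forall t, measurable (tau @^-1` [set t])) /\ forall x, (tau x < M)%N.

Lemma additive_labelling (mu : set T -> \bar R) M tau A :
  additive_set_fun mu -> labelling M tau -> measurable A ->
  mu A = \sum_(k < M) mu (A `&` tau @^-1` [set (k : nat)]).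
Proof.
move=> [mu0 muU] [mtau tauM] mA.
have mlt p : measurable (tau @^-1` [set k | (k < p)%N]).
  rewrite (_ : _ @^-1` _ = \bigcup_(k in [set k | (k < p)%N]) tau @^-1` [set k]).
    by apply: bigcup_measurable => k _.
  by apply/seteqP; split => [x h|x [k kp /= ->]//]; exists (tau x).
suff H p : mu (A `&` tau @^-1` [set k | (k < p)%N]) =
    \sum_(k < p) mu (A `&` tau @^-1` [set (k : nat)]).
  rewrite -H; congr mu; apply/seteqP; split => [x Ax|x []//].
  by split => //; exact: tauM.
elim: p => [|p IH].
  rewrite big_ord0 -[RHS]mu0; congr mu.
  by apply/seteqP; split => // x [].
rewrite big_ord_recr/= -IH -muU; last first.
- by apply/seteqP; split => // x /= [[_ h] [_ e]]; rewrite e ltnn in h.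
- exact: measurableI.
- exact: measurableI.
congr mu; apply/seteqP; split => x /=.
  by move=> [Ax]; rewrite ltnS leq_eqVlt => /orP[/eqP|]; [right|left].
by move=> [[Ax h]|[Ax ->]]; split => //; exact: ltnW.
Qed.

(** The label of x is the number whose binary digits record to which of the m sets x belongs, the
    newest set giving the lowest bit. Points with equal labels thus lie in the same sets. *)
Lemma exists_labelling (A : nat -> set T) m : (forall i, measurable (A i)) ->
  exists M tau, labelling M tau /\
    forall i x y, (i < m)%N -> tau x = tau y -> A i x -> A i y.
Proof.
move=> mA; elim: m => [|m [M [tau [[mtau tauM] sat]]]].
  exists 1%N, (fun=> 0%N); split => //; split => // t.
  case: t => [|t]; first by rewrite (_ : _ @^-1` _ = setT)//; apply/seteqP.
  by rewrite (_ : _ @^-1` _ = set0)//; apply/seteqP; split.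
exists M.*2, (fun x => `[< A m x >] + (tau x).*2)%N; split; first split.
- move=> t; rewrite (_ : _ @^-1` _ =
      (if odd t then A m else ~` A m) `&` tau @^-1` [set t./2]).
    by apply: measurableI => //; case: ifP => // _; exact: measurableC.
  apply/seteqP; split => x /=.
    move=> <-; rewrite oddD odd_double addbF half_bit_double; split => //.
    by case: asboolP.
  move=> [h ->]; rewrite -[RHS]odd_double_half; congr (_ + _)%N.
  by case: asboolP; case: (odd t) h.
- move=> x; rewrite (@leq_ltn_trans ((tau x).*2.+1))//.
    by rewrite -add1n leq_add2r leq_b1.
  by rewrite ltn_Sdouble.
- move=> i x y; rewrite ltnS leq_eqVlt => /orP[/eqP ->|im] e.
    move/(congr1 odd): e; rewrite !oddD !odd_double !addbF !oddb => e /asboolP.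
    by rewrite e => /asboolP.
  by apply: sat => //; move/(congr1 half): e; rewrite !half_bit_double.
Qed.

End law_from_generating_functions.

(** * Equality of laws from equality of generating functions *)

Section same_law.
Local Open Scope ereal_scope.
Context {R : realType} {d} {T : measurableType d}.
Context {d1 d2} {S1 : measurableType d1} {S2 : measurableType d2}.
Variables (P1 : probability S1 R) (P2 : probability S2 R).
Variables (X1 : S1 -> set T -> \bar R) (X2 : S2 -> set T -> \bar R).
Hypothesis mX1 : forall A, measurable A -> measurable_fun setT (X1 ^~ A).
Hypothesis mX2 : forall A, measurable A -> measurable_fun setT (X2 ^~ A).
Hypothesis addX1 : forall x, additive_set_fun (X1 x).
Hypothesis addX2 : forall x, additive_set_fun (X2 x).
Hypothesis X2_count : forall x A, measurable A -> exists j : nat, X2 x A = j%:R%:E.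
Hypothesis gen_fun_eq : forall M tau (z : nat -> R), @labelling _ T M tau ->
  (forall k, 0 < z k < 1)%R ->
  \int[P1]_x \prod_(k < M) pow (z k) (to_count (X1 x (tau @^-1` [set (k : nat)])))
  = \int[P2]_x \prod_(k < M) pow (z k) (to_count (X2 x (tau @^-1` [set (k : nat)]))).

Let label_counts_eq M tau (c : nat -> nat) : @labelling _ T M tau ->
  P1 [set x | forall k, (k < M)%N -> X1 x (tau @^-1` [set k]) = (c k)%:R%:E] =
  P2 [set x | forall k, (k < M)%N -> X2 x (tau @^-1` [set k]) = (c k)%:R%:E].
Proof.
move=> lab; have [mtau _] := lab.
pose N1 k x := to_count (X1 x (tau @^-1` [set k])).
pose N2 k x := to_count (X2 x (tau @^-1` [set k])).
have mN1 k j : measurable [set x | N1 k x = Some j].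
  by apply: measurable_to_count; exact: mX1.
have mN2 k j : measurable [set x | N2 k x = Some j].
  by apply: measurable_to_count; exact: mX2.
rewrite (_ : [set x | _] = setT `&`
    [set x | forall k, (k < M)%N -> N1 k x = Some (c k)]); last first.
  by rewrite setTI; apply/seteqP; split => x h k kM; apply/to_countP; exact: h.
rewrite -integral_prod_delta//.
rewrite [in RHS](_ : [set x | _] = setT `&`
    [set x | forall k, (k < M)%N -> N2 k x = Some (c k)]); last first.
  by rewrite setTI; apply/seteqP; split => x h k kM; apply/to_countP; exact: h.
rewrite -integral_prod_delta//.
have I01 dd (S : measurableType dd) (x : S) : 0 <= (\1_[set: S] x)%:E <= (1 : \bar R).
  by rewrite indicE in_setT; apply/andP; split; rewrite lee_fin.
have IE dd (S : measurableType dd) (P : probability S R) (f : S -> \bar R) :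
    \int[P]_x ((\1_[set: S] x)%:E * f x) = \int[P]_x f x.
  by apply: eq_integral => x _; rewrite indicT/= mul1e.
apply: joint_gen_fun_inj => //.
- by apply/measurable_EFinP; exact: measurable_indic.
- by apply/measurable_EFinP; exact: measurable_indic.
- by move=> z z01; rewrite !IE; exact: gen_fun_eq.
Qed.

(** An inequality, since finiteness is assumed of [X2] alone. Its event is a disjoint union over the
    vectors of finite cell counts compatible with Q. Each of these vectors is equally likely for
    [X1], but for [X1] they cover only part of the event, infinite cell counts being left out. *)
Let cylinder_le m (A : nat -> set T) (Q : set (nat -> \bar R)) :
  (forall i, measurable (A i)) ->
  (forall u v, (forall i, (i < m)%N -> u i = v i) -> Q u -> Q v) ->
  measurable [set x | Q (fun i => X1 x (A i))] ->
  measurable [set x | Q (fun i => X2 x (A i))] ->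
  P2 [set x | Q (fun i => X2 x (A i))] <= P1 [set x | Q (fun i => X1 x (A i))].
Proof.
move=> mA Qm mQ1 mQ2.
have [M [tau [lab sat]]] := exists_labelling m mA; have [mtau _] := lab.
(* By [sat] a cell meeting [A i], i < m, is contained in it. *)
pose sel i k := `[< exists2 x, tau x = k & A i x >].
have selP i k : (i < m)%N -> A i `&` tau @^-1` [set k] =
    if sel i k then tau @^-1` [set k] else set0.
  move=> im; case: ifPn => [/asboolP[x xk Aix]|/asboolPn h].
    apply/seteqP; split => [y []//|y /= yk]; split => //.
    by apply: (sat i x y) => //; rewrite xk yk.
  by apply/seteqP; split => // x [Aix xk]; apply: h; exists x.
(* The value on [A i] forced by the cell counts v. *)
pose val (v : seq nat) i : \bar R :=
  \sum_(k < M) if sel i k then (nth 0%N v k)%:R%:E else 0.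
pose ev dd (S : measurableType dd) (X : S -> set T -> \bar R) (v : seq nat) :=
  [set x | forall k, (k < M)%N -> X x (tau @^-1` [set k]) = (nth 0%N v k)%:R%:E].
(* The vectors are enumerated through their codes. Fixing the length M makes v the only vector for
   given counts, so that these events are disjoint. *)
pose F dd (S : measurableType dd) (X : S -> set T -> \bar R) (n : nat) :=
  if pickle_inv n is Some v then
    if `[< size v = M /\ Q (val v) >] then ev dd S X v else set0
  else set0.
have evQ dd (S : measurableType dd) (X : S -> set T -> \bar R) v x i :
    (forall x, additive_set_fun (X x)) -> (i < m)%N ->
    ev dd S X v x -> X x (A i) = val v i.
  move=> addX im h; rewrite (additive_labelling (addX x) lab (mA i)).
  apply: eq_bigr => k _; rewrite selP//; case: ifP => _; first exact: h.
  by case: (addX x).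
have mF dd (S : measurableType dd) (X : S -> set T -> \bar R) n :
    (forall A, measurable A -> measurable_fun setT (X ^~ A)) ->
    measurable (F dd S X n).
  move=> mX; rewrite /F; case: pickle_inv => // v; case: ifP => // _.
  apply: (@measurable_forall_ltn _ _ M (fun k =>
    [set x | X x (tau @^-1` [set k]) = (nth 0%N v k)%:R%:E])) => k.
  by rewrite -[X in measurable X]setTI;
    exact: (mX _ (mtau k) measurableT _ (emeasurable_set1 _)).
have tF dd (S : measurableType dd) (X : S -> set T -> \bar R) :
    trivIset setT (F dd S X).
  move=> n n' _ _; rewrite /F.
  have := @pickle_invK (seq nat) n; case: pickle_inv => [v|] /=; last first.
    by move=> _ [x []].
  move=> <-.
  have := @pickle_invK (seq nat) n'; case: pickle_inv => [v'|] /=; last first.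
    by move=> _ [x []].
  move=> <-; case: ifPn => [/asboolP[sv _]|_]; last by move=> [x []].
  case: ifPn => [/asboolP[sv' _]|_]; last by move=> [x []].
  move=> [x [h h']]; congr pickle; apply: (@eq_from_nth _ 0%N).
    by rewrite sv sv'.
  move=> k; rewrite sv => kM; have := h k kM; rewrite h'// => -[/eqP].
  by rewrite eqr_nat => /eqP.
have Psum dd (S : measurableType dd) (P : probability S R)
    (X : S -> set T -> \bar R) :
    (forall A, measurable A -> measurable_fun setT (X ^~ A)) ->
    P (\bigcup_n F dd S X n) = \sum_(n <oo) P (F dd S X n).
  move=> mX; apply: measure_semi_bigcup; [by move=> n; exact: mF|exact: tF|].
  by apply: bigcup_measurable => n _; exact: mF.
apply: (@le_trans _ _ (P2 (\bigcup_n F _ _ X2 n))).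
  apply: le_measure; rewrite ?inE//.
    by apply: bigcup_measurable => n _; exact: mF.
  move=> x /= Qx.
  (* Here the finiteness of the counts of [X2] enters. *)
  have /choice[c cP] : forall k : nat, exists j : nat,
      X2 x (tau @^-1` [set k]) = j%:R%:E by move=> k; exact: X2_count.
  pose v := mkseq c M; exists (pickle v) => //; rewrite /F pickleK_inv.
  have evx : ev _ _ X2 v x by move=> k kM; rewrite nth_mkseq.
  case: ifPn => // /asboolPn []; split; first exact: size_mkseq.
  by apply: Qm Qx => i im; exact: evQ.
apply: (@le_trans _ _ (P1 (\bigcup_n F _ _ X1 n))).
  rewrite !Psum// lee_nneseries// => n _; rewrite /F.
  case: pickle_inv => [v|]; last by rewrite !measure0.
  case: ifP => _; last by rewrite !measure0.
  by rewrite /ev -label_counts_eq.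
apply: le_measure; rewrite ?inE//.
  by apply: bigcup_measurable => n _; exact: mF.
move=> x [n _]; rewrite /F; case: pickle_inv => // v.
case: ifP => // /asboolP[_ Qv] evx /=.
by apply: Qm Qv => i im; apply/esym; exact: evQ.
Qed.

(** Dynkin's pi-lambda theorem. The class H also records that both preimages are measurable, which
    is needed to compute with complements and disjoint unions. *)
Lemma same_law_gen_fun : same_law P1 X1 P2 X2.
Proof.
pose cyl (mAV : nat * (nat -> set T) * (nat -> set (\bar R))) :=
  [set mu : set T -> \bar R | forall i, (i < mAV.1.1)%N -> mAV.2 i (mu (mAV.1.2 i))].
pose ok (mAV : nat * (nat -> set T) * (nat -> set (\bar R))) :=
  (forall i, measurable (mAV.1.2 i)) /\ (forall i, measurable (mAV.2 i)).
pose G := cyl @` ok.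
pose H C := [/\ measurable (X1 @^-1` C), measurable (X2 @^-1` C) &
  P1 (X1 @^-1` C) = P2 (X2 @^-1` C)].
have subGH : <<s G >> `<=` H.
  apply: lambda_system_subset => //.
  - move=> _ _ [[[m A] V] [/= mA mV] <-] [[[m' A'] V'] [/= mA' mV'] <-].
    (* Two cylinders intersect in the cylinder over the concatenated lists of sets. *)
    exists ((m + m')%N, (fun i => if (i < m)%N then A i else A' (i - m)%N),
      (fun i => if (i < m)%N then V i else V' (i - m)%N)).
      by split => i /=; case: ifP.
    apply/seteqP; split => mu; rewrite /cyl/=.
      move=> h; split => i im.
        by have := h i (ltn_addr _ im); rewrite im.
      have := h (m + i)%N; rewrite ltn_add2l => /(_ im).
      by rewrite ltnNge leq_addr/= addKn.
    move=> [h h'] i im; case: ifPn => [|]; first exact: h.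
    by rewrite -leqNgt => mi; apply: h'; rewrite ltn_subLR.
  - apply/dynkin_lambda_system; split.
    + split; rewrite !preimage_setT; [exact: measurableT|exact: measurableT|].
      by rewrite (probability_setT P1) (probability_setT P2).
    + move=> C [m1 m2 e].
      split; [exact: (measurableC m1)|exact: (measurableC m2)|].
      exact: (etrans (probability_setC P1 m1)
        (etrans (congr1 (fun t => 1 - t) e) (esym (probability_setC P2 m2)))).
    + move=> F tF HF.
      have mF1 k : measurable (X1 @^-1` F k) by case: (HF k).
      have mF2 k : measurable (X2 @^-1` F k) by case: (HF k).
      have tF1 : trivIset setT (fun k => X1 @^-1` F k).
        by move=> i j _ _ [x [h h']]; apply: (tF i j) => //; exists (X1 x).
      have tF2 : trivIset setT (fun k => X2 @^-1` F k).
        by move=> i j _ _ [x [h h']]; apply: (tF i j) => //; exists (X2 x).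
      have mU1 : measurable (\bigcup_n X1 @^-1` F n).
        by apply: bigcup_measurable => n _; exact: mF1.
      have mU2 : measurable (\bigcup_n X2 @^-1` F n).
        by apply: bigcup_measurable => n _; exact: mF2.
      split; rewrite ?(preimage_bigcup setT X1 F) ?(preimage_bigcup setT X2 F)//.
      apply: (etrans (measure_semi_bigcup P1 mF1 tF1 mU1)).
      apply: (etrans _ (esym (measure_semi_bigcup P2 mF2 tF2 mU2))).
      by apply: eq_eseriesr => k _; case: (HF k).
  - move=> _ [[[m A] V] [/= mA mV] <-].
    have mcyl dd (S : measurableType dd) (X : S -> set T -> \bar R) :
        (forall A, measurable A -> measurable_fun setT (X ^~ A)) ->
        measurable (X @^-1` cyl (m, A, V)).
      move=> mX.
      apply: (@measurable_forall_ltn _ _ m (fun i => [set x | V i (X x (A i))])) => i.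
      by rewrite -[X in measurable X]setTI;
        exact: (mX _ (mA i) measurableT _ (mV i)).
    split; [exact: mcyl|exact: mcyl|].
    pose Q := [set u : nat -> \bar R | forall i, (i < m)%N -> V i (u i)].
    have Qm u v : (forall i, (i < m)%N -> u i = v i) -> Q u -> Q v.
      by move=> uv h i im; rewrite -uv//; exact: h.
    (* [cylinder_le] for Q and for its complement gives the equality *)
    apply/eqP; rewrite eq_le; apply/andP; split; last first.
      exact: (@cylinder_le m A Q mA Qm (mcyl _ _ _ mX1) (mcyl _ _ _ mX2)).
    have QmC u v : (forall i, (i < m)%N -> u i = v i) -> (~` Q) u -> (~` Q) v.
      by move=> uv nQ Qv; apply: nQ; apply: Qm Qv => i im; rewrite uv.
    have := @cylinder_le m A (~` Q) mA QmC (measurableC (mcyl _ _ _ mX1))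
      (measurableC (mcyl _ _ _ mX2)).
    rewrite -[X in P2 X]/(~` (X2 @^-1` cyl (m, A, V))).
    rewrite -[X in P1 X]/(~` (X1 @^-1` cyl (m, A, V))).
    rewrite !probability_setC; [|exact: mcyl..].
    by rewrite leeD2lE// leeN2.
move=> C sC; suff [] : H C by [].
apply: subGH; move: C sC; apply: smallest_sub.
  exact: smallest_sigma_algebra.
move=> C [A mA [V mV <-]]; apply: sub_sigma_algebra; exists (1%N, (fun=> A), (fun=> V)).
  by split.
rewrite setTI; apply/seteqP; split => mu /=; first by move=> /(_ 0%N isT).
by move=> Vmu i _.
Qed.
End same_law.

(** * Laplace functional of a Poisson random measure *)

Section exponentials.
Local Open Scope ereal_scope.
Context {R : realType}.

Lemma expeRN_le1 (x : \bar R) : 0 <= x -> expeR (- x) <= 1.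
Proof. by move=> x0; rewrite -expeR0 lee_expeR leeNl oppe0. Qed.

Lemma expeRN_fin_num (x : \bar R) : 0 <= x -> expeR (- x) \is a fin_num.
Proof.
by move=> x0; rewrite ge0_fin_numE ?expeR_ge0// (le_lt_trans (expeRN_le1 x0))// ltry.
Qed.

Lemma expeRN_sum m (u : nat -> \bar R) : (forall k, 0 <= u k) ->
  expeR (- \sum_(k < m) u k) = \prod_(k < m) expeR (- u k).
Proof.
move=> u0; elim: m => [|m IH]; first by rewrite !big_ord0 oppe0 expeR0.
rewrite !big_ord_recr/= oppeD ?expeRD ?IH// ge0_adde_def// inE//.
by apply: sume_ge0.
Qed.

(** Continuity of u |-> e^(-u) up to u = +oo, a value that point sums may take; there, e^(-u) <= e
    as soon as u exceeds - ln e. *)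
Lemma cvg_expeRN (u : nat -> \bar R) l : (forall n, 0 <= u n) ->
  u @ \oo --> l -> expeR (- u n) @[n --> \oo] --> expeR (- l).
Proof.
move=> u0 ul; have l0 : 0 <= l.
  by rewrite -(cvg_lim _ ul)//; apply: lime_ge; [apply/cvg_ex; exists l|exact: nearW].
case: l l0 ul => [r| |//] l0 ul.
  move/fine_cvgP : ul => [fin cv].
  apply: (@cvg_trans _ ((expR (- fine (u n)))%:E @[n --> \oo])).
    apply: near_eq_cvg; near=> n.
    have un : u n \is a fin_num by near: n.
    by rewrite -{2}(fineK un).
  apply: cvg_EFin; first exact: nearW.
  exact: (continuous_cvg _ (@continuous_expR R (- r)%R) (cvgN cv)).
rewrite [expeR _]/=; apply/fine_cvgP; split.
  by apply: nearW => n; exact: expeRN_fin_num.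
apply/cvgr0Pnorm_le => e e0; move/cvgeyPge : ul => /(_ (- ln e)%R) ul.
near=> n; have : (- ln e)%:E <= u n by near: n.
have un := expeRN_fin_num (u0 n).
rewrite /= ger0_norm ?fine_ge0 ?expeR_ge0// -lee_fin fineK// => h.
rewrite (@le_trans _ _ (expeR (ln e)%:E))//; last by rewrite /= lnK.
by rewrite lee_expeR leeNl -EFinN.
Unshelve. all: by end_near. Qed.

Lemma measurable_expeRN d (S : measurableType d) (f : S -> \bar R) :
  (forall x, 0 <= f x) -> measurable_fun setT f ->
  measurable_fun setT (fun x => expeR (- f x)).
Proof.
(* As [fine] sends +oo to 0, the real exponential would be 1 there; the indicator of finiteness
   restores the value 0. *)
move=> f0 mf; rewrite (_ : (fun x => _) = fun x =>
    (expR (- fine (f x)))%:E * (\1_(f @^-1` (~` [set +oo%E])) x)%:E).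
  apply: emeasurable_funM; apply/measurable_EFinP.
    apply: measurableT_comp; first exact: measurable_expR.
    by apply: measurableT_comp => //; exact: measurableT_comp.
  apply: measurable_indic; rewrite -[X in measurable X]setTI.
  by apply: mf => //; exact: measurableC.
apply/funext => x; rewrite indicE; have := f0 x; case E : (f x) => [r| |]//= _.
  by rewrite mem_set ?mule1//= E.
by rewrite memNset ?mule0//= E; exact.
Qed.

Lemma exp_series (x : R) : (0 <= x)%R ->
  \sum_(j <oo) (x ^+ j / j`!%:R)%:E = (expR x)%:E.
Proof.
move=> x0; rewrite /expR -EFin_lim; last exact: is_cvg_series_exp_coeff.
congr (lim (_ @ \oo)); apply/funext => n /=; rewrite /series/=.
by rewrite sumEFin; congr _%:E; apply: eq_bigr => j _; rewrite exp_coeffE/= mulrC.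
Qed.

Lemma Po_gen_fun (lam z : R) : (0 <= lam)%R -> (0 <= z)%R ->
  \sum_(j <oo) ((z ^+ j)%:E * (Po lam j)%:E) = (expR (- ((1 - z) * lam)))%:E.
Proof.
move=> lam0 z0.
transitivity (\sum_(j <oo) ((expR (- lam))%:E * ((z * lam) ^+ j / j`!%:R)%:E)).
  apply: eq_eseriesr => j _; rewrite -!EFinM /Po exprMn; congr _%:E.
  by rewrite !mulrA; congr (_ * _ / _)%R; exact: mulrC.
rewrite nneseriesZl; last first.
  by move=> j _; rewrite lee_fin mulr_ge0// ?invr_ge0// exprn_ge0// mulr_ge0.
rewrite exp_series ?mulr_ge0// -EFinM -expRD; congr (expR _)%:E.
by rewrite mulrBl mul1r opprB addrC.
Qed.

Lemma Po_ge0 (lam : R) j : (0 <= lam)%R -> (0 <= Po lam j)%R.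
Proof. by move=> lam0; rewrite /Po mulr_ge0// mulr_ge0 ?expR_ge0// exprn_ge0. Qed.

Lemma ePo_ge0 (lam : \bar R) v : 0 <= lam -> (0 <= ePo lam v)%R.
Proof.
by case: lam => [lam| |]//; case: v => [j|]//= lam0; rewrite Po_ge0.
Qed.

(** For an infinite mean every finite count has mass 0, and the right-hand side is e^(-oo) = 0
    because z < 1; at z = 1 it would be 1. *)
Lemma ePo_gen_fun (lam : \bar R) (z : R) : 0 <= lam -> (0 <= z < 1)%R ->
  \sum_(j <oo) ((z ^+ j)%:E * (ePo lam (Some j))%:E) =
  expeR (- ((1 - z)%:E * lam)).
Proof.
move=> + /andP[z0 z1]; case: lam => [lam|_|//]; first by move=> l0; exact: Po_gen_fun.
rewrite eseries0; last by move=> j _ _; rewrite /= mule0.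
by rewrite gt0_muley ?lte_fin ?subr_gt0.
Qed.

End exponentials.

(** * Sums over a random set of points *)

Section point_sums.
Local Open Scope ereal_scope.
Context {R : realType}.

Lemma esum_nneseries (K : set nat) (F : nat -> \bar R) :
  (forall k, K k -> 0 <= F k) ->
  \esum_(k in K) F k = \sum_(k <oo) (if k \in K then F k else 0).
Proof.
move=> F0; rewrite esum_mkcond nneseries_esumT// => k.
by case: ifPn => // /set_mem; exact: F0.
Qed.

Lemma measurable_fun_if_mem d (S : measurableType d) (K : S -> set nat) k
    (F : S -> \bar R) :
  measurable [set x | K x k] -> measurable_fun setT F ->
  measurable_fun setT (fun x => if k \in K x then F x else 0).
Proof.
move=> mK mF; rewrite (_ : (fun x => _) = fun x => F x * (\1_[set x | K x k] x)%:E).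
  by apply: emeasurable_funM => //; apply/measurable_EFinP; exact: measurable_indic.
apply/funext => x; rewrite indicE; case: ifPn => [/set_mem h|/negP h].
  by rewrite mem_set// mule1.
by rewrite memNset ?mule0// => h'; apply: h; exact: mem_set.
Qed.

Lemma measurable_point_sum d (S : measurableType d) (K : S -> set nat)
    (F : nat -> S -> \bar R) :
  (forall k, measurable [set x | K x k]) ->
  (forall k, measurable_fun setT (F k)) -> (forall k x, K x k -> 0 <= F k x) ->
  measurable_fun setT (fun x => \esum_(k in K x) F k x).
Proof.
move=> mK mF F0; rewrite (_ : (fun x => _) = fun x =>
    \sum_(k <oo | k \in xpredT) (if k \in K x then F k x else 0)).
  apply: ge0_emeasurable_sum => [k x _ _|k _].
    by case: ifPn => // /set_mem; exact: F0.
  exact: measurable_fun_if_mem.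
by apply/funext => x; rewrite esum_nneseries// => k; exact: F0.
Qed.

(** Monotone convergence for the counting measure, the index set being absorbed into the
    integrand. *)
Lemma cvg_point_sum (K : set nat) (F : nat -> nat -> \bar R) (f : nat -> \bar R) :
  (forall n k, 0 <= F n k) -> (forall k, nondecreasing_seq (F^~ k)) ->
  (forall k, F n k @[n --> \oo] --> f k) ->
  \esum_(k in K) F n k @[n --> \oo] --> \esum_(k in K) f k.
Proof.
move=> F0 ndF Ff.
have f0 k : 0 <= f k.
  rewrite -(cvg_lim _ (Ff k))//; apply: lime_ge; last exact: nearW.
  by apply/cvg_ex; exists (f k).
pose G n k := if k \in K then F n k else 0.
pose g k := if k \in K then f k else 0.
have Gg k : G n k @[n --> \oo] --> g k.
  by rewrite /G /g; case: ifP => _; [exact: Ff|exact: cvg_cst].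
have G0 n k : 0 <= G n k by rewrite /G; case: ifP.
have ndG k : nondecreasing_seq (G^~ k).
  by move=> m n mn; rewrite /G; case: ifP => // _; exact: ndF.
have -> : \esum_(k in K) f k = \int[counting]_k g k.
  rewrite esum_nneseries ?ge0_integral_count// => k.
  by rewrite /g; case: ifP.
have -> : (fun n => \esum_(k in K) F n k) = fun n => \int[counting]_k G n k.
  by apply/funext => n; rewrite esum_nneseries// ge0_integral_count.
have -> : \int[counting]_k g k = \int[counting]_k limn (G^~ k).
  by apply: eq_integral => k _; apply/esym/cvg_lim.
by apply: cvg_monotone_convergence => // k _; exact: ndG.
Qed.

(** If the series converges, its tails are eventually below 1; so are its terms, which are then 0,
    and the sum is finite. *)
Lemma nat_series_count (b : nat -> nat) :
  \sum_(k <oo) (b k)%:R%:E = +oo :> \bar R \/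
  exists j : nat, \sum_(k <oo) (b k)%:R%:E = j%:R%:E :> \bar R.
Proof.
have [[n0 b0]|] := pselect (exists n0, forall k, (n0 <= k)%N -> b k = 0%N).
  right; exists (\sum_(k < n0) b k)%N.
  rewrite (nneseries_split 0 n0); last by move=> k _; rewrite lee_fin.
  rewrite [X in _ + X]eseries0 ?adde0; last by move=> k + _; rewrite add0n => /b0 ->.
  by rewrite add0n big_mkord sumEFin natr_sum.
move=> H; left; apply/eqP; rewrite -leye_eq leNgt; apply/negP => fin.
have b0 k : 0 <= (b k)%:R%:E :> \bar R by rewrite lee_fin.
have /fine_cvgP[tfin /cvgr0Pnorm_lt/(_ _ ltr01) tlt] :=
  nneseries_tail_cvg fin (fun k _ => b0 k).
have [n1 _ h1] := tfin; have [n2 _ h2] := tlt.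
apply: H; exists (maxn n1 n2) => k; rewrite geq_max => /andP[n1k n2k].
have {}h1 := h1 k n1k; have := h2 k n2k.
rewrite /= ger0_norm ?fine_ge0 ?nneseries_ge0// -lte_fin fineK// => tail_lt1.
have : (b k)%:R%:E < 1%:E :> \bar R.
  apply: le_lt_trans tail_lt1; rewrite (nneseries_split k 1)// addn1 big_nat1.
  by rewrite leeDl// nneseries_ge0.
by rewrite lte_fin ltrn1; case: (b k).
Qed.

(** The substitution z = e^(-a) between generating functions and Laplace transforms. Positivity of a
    makes both sides 0 at u = +oo. *)
Lemma pow_expR (u : \bar R) (a : R) : (0 < a)%R ->
  u = +oo \/ (exists j : nat, u = j%:R%:E) ->
  pow (expR (- a)) (to_count u) = expeR (- (a%:E * u)).
Proof.
move=> a0 [->|[j ->]].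
  rewrite gt0_muley// /= (_ : to_count _ = None)//.
  case E : (to_count _) => [j|//].
  by have /to_countP := E.
by rewrite to_countK/= -expRM_natl mulrN mulrC.
Qed.

End point_sums.

Section poisson_laplace.
Local Open Scope ereal_scope.
Context {R : realType} {dX} {X : measurableType dX}.
Context {dS} {S : measurableType dS} (P : probability S R).
Variables (nu : {measure set X -> \bar R}) (M : S -> set X -> \bar R).
Hypothesis mM : forall B, measurable B -> measurable_fun setT (M ^~ B).
Hypothesis M_count : forall x B, M x B = +oo \/ exists j : nat, M x B = j%:R%:E.
Hypothesis M_prm : poisson_random_measure P nu M.

(** Independence over disjoint sets yields a product of Poisson generating functions, taken at z =
    e^(-a k); infinite counts contribute 0. *)
Lemma poisson_laplace_disjoint m (B : nat -> set X) (a : nat -> R) :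
  (forall k, measurable (B k)) -> (forall k, 0 < a k)%R ->
  (forall i j, (i < m)%N -> (j < m)%N -> B i `&` B j !=set0 -> i = j) ->
  \int[P]_x \prod_(k < m) expeR (- ((a k)%:E * M x (B k))) =
  \prod_(k < m) expeR (- ((1 - expR (- a k))%:E * nu (B k))).
Proof.
move=> mB a0 tB.
transitivity (\int[P]_x (1 * \prod_(k < m)
    oapp (fun j => (expR (- a k) ^+ j)%:E) 0 (to_count (M x (B k))))).
  apply: eq_integral => x _; rewrite mul1e; apply: eq_bigr => k _.
  by rewrite -pow_expR.
rewrite (@integral_prod_mixture _ _ _ _ _ 0%N m (fun=> 1) (fun=> 1)
  (fun k x => to_count (M x (B k)))
  (fun k j _ => (ePo (nu (B k)) (Some j))%:E)
  (fun k j => (expR (- a k) ^+ j)%:E))//; last 3 first.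
- by move=> k j; apply: measurable_to_count; exact: mM.
- by move=> k j _; rewrite lee_fin ePo_ge0.
- move=> c.
  transitivity (P (setT `&`
      [set x | forall k, (k < m)%N -> to_count (M x (B k)) = Some (c k)])).
    rewrite -integral_prod_delta//; last first.
      by move=> k j; apply: measurable_to_count; exact: mM.
    by apply: eq_integral => x _; rewrite indicT.
  under eq_integral do rewrite mul1e.
  rewrite integral_cst//= (@probability_setT _ _ _ P) mule1 setTI.
  have := M_prm (B := fun i : 'I_m => B i) (fun i : 'I_m => Some (c i)) (fun i => mB i).
  rewrite (_ : [set x | _] =
      [set x | forall k, (k < m)%N -> to_count (M x (B k)) = Some (c k)]); last first.
    apply/seteqP; split => x /= h.
      by move=> k km; apply/to_countP; exact: (h (Ordinal km)).
    by move=> [k km]; apply/to_countP; exact: h.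
  move=> ->; first by rewrite -prodEFin.
  by move=> i j _ _ /(tB i j (ltn_ord i) (ltn_ord j))/val_inj.
under eq_integral do rewrite mul1e.
rewrite integral_cst//= (@probability_setT _ _ _ P) mule1; apply: eq_bigr => k _.
rewrite -nneseries_esumT; last first.
  by move=> j; rewrite mule_ge0// lee_fin ?ePo_ge0// exprn_ge0// expR_ge0.
apply: ePo_gen_fun => //; rewrite expR_ge0/=.
by rewrite -expR0 ltr_expR oppr_lt0.
Qed.

End poisson_laplace.

Section points.
Local Open Scope ereal_scope.
Context {R : realType} {d} {T : measurableType d}.
Context {dS} {S : measurableType dS} (P : probability S R).
Variables (K : S -> set nat) (r : nat -> {mfun S >-> R}) (w : nat -> {mfun S >-> T}).
Hypothesis mK : forall k, measurable [set x | K x k].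

Lemma measurable_counting_points B : measurable B ->
  measurable_fun setT (fun x => counting_points K r w x B).
Proof.
move=> mB; apply: measurable_point_sum => // k.
apply: (measurableT_comp (measurable_fun_dirac mB)).
exact: measurable_fun_pair.
Qed.

Lemma counting_points_count x B : counting_points K r w x B = +oo \/
  exists j : nat, counting_points K r w x B = j%:R%:E.
Proof.
rewrite /counting_points esum_nneseries//.
have E : \sum_(k <oo) (if k \in K x then \d_(r k x, w k x) B else 0) =
    \sum_(k <oo) (if k \in K x then ((r k x, w k x) \in B : nat) else 0%N)%:R%:E :> \bar R.
  by apply: eq_eseriesr => k _; case: ifP.
rewrite E; exact: nat_series_count.
Qed.

Lemma esum_points_cvg (h : nat -> R * T -> R) (f : R * T -> R) x :
  (forall n p, 0 <= h n p)%R -> (forall p, nondecreasing_seq (h^~ p)) ->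
  (forall p, (h n p)%:E @[n --> \oo] --> (f p)%:E) ->
  \esum_(k in K x) (h n (r k x, w k x))%:E @[n --> \oo] -->
  \esum_(k in K x) (f (r k x, w k x))%:E.
Proof.
move=> h0 ndh hf; apply: cvg_point_sum => //; first by move=> n k; rewrite lee_fin.
by move=> k m n mn; rewrite lee_fin ndh.
Qed.

Lemma measurable_esum_points (f : R * T -> R) :
  (forall p, 0 <= f p)%R -> measurable_fun setT f ->
  measurable_fun setT (fun x => \esum_(k in K x) (f (r k x, w k x))%:E).
Proof.
move=> f0 mf; apply: measurable_point_sum => // [k|k x _]; last by rewrite lee_fin.
apply/measurable_EFinP; apply: (measurableT_comp mf); exact: measurable_fun_pair.
Qed.

Variable nu : {measure set (R * T) -> \bar R}.
Hypothesis prm : poisson_random_measure P nu (counting_points K r w).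

Import HBNNSimple.

(** The level sets of the positive values of h are finitely many disjoint sets. The level set of 0
    is left out: it contributes 0 to both exponents. *)
Lemma poisson_laplace_simple (h : {nnsfun (R * T) >-> R}) :
  \int[P]_x expeR (- \esum_(k in K x) (h (r k x, w k x))%:E) =
  expeR (- \int[nu]_p (1 - expR (- h p))%:E).
Proof.
pose s := [seq v <- finmap.enum_fset (fset_set (range h)) | (0 < v)%R].
have s_uniq : uniq s by rewrite filter_uniq// finmap.fset_uniq.
have sP p : (0 < h p)%R -> h p \in s.
  by move=> hp; rewrite mem_filter hp/= in_fset_set// inE; exists p.
(* The default 1 keeps [a k] positive for every k, even beyond the list. *)
pose a k := nth 1%R s k.
have a0 k : (0 < a k)%R.
  rewrite /a; have [ks|ks] := ltnP k (size s); last by rewrite nth_default.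
  by have := mem_nth 1%R ks; rewrite mem_filter => /andP[].
pose B k := h @^-1` [set a k].
have mB k : measurable (B k) by exact: measurable_sfunP.
have tB i j : (i < size s)%N -> (j < size s)%N -> B i `&` B j !=set0 -> i = j.
  move=> si sj [p [/= pi pj]]; apply/eqP; rewrite -(nth_uniq 1%R si sj s_uniq).
  by rewrite -[nth _ _ i]/(a i) -pi pj.
(* h takes the value 0 or exactly one of the values a k *)
have decomp (g : R -> R) p : g 0%R = 0%R ->
    (g (h p))%:E = \sum_(k < size s) ((g (a k))%:E * (\1_(B k) p)%:E).
  move=> g0; have : (0 <= h p)%R by exact: fun_ge0.
    rewrite le_eqVlt => /predU1P[hp|hp].
    rewrite -hp g0 big1// => k _; rewrite indicE memNset ?mule0// => /= e.
    by have := a0 k; rewrite -e -hp ltxx.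
  have si : (index (h p) s < size s)%N by rewrite index_mem sP.
  have ai : a (index (h p) s) = h p by rewrite /a nth_index// sP.
  rewrite (bigD1 (Ordinal si))//= big1 ?adde0.
    by rewrite ai indicE mem_set ?mule1//= /B ai.
  move=> k ki; rewrite indicE memNset ?mule0// => /= e.
  move/eqP: ki; apply; apply: val_inj => /=; apply: tB => //.
  by exists p; split => //=; rewrite ai.
transitivity (\int[P]_x \prod_(k < size s)
    expeR (- ((a k)%:E * counting_points K r w x (B k)))).
  apply: eq_integral => x _; rewrite -(expeRN_sum (size s)
    (u := fun k => (a k)%:E * counting_points K r w x (B k))); last first.
    by move=> k; apply: mule_ge0; [rewrite lee_fin ltW|exact: esum_ge0].
  congr (expeR (- _)); rewrite esum_nneseries; last by move=> k _; rewrite lee_fin.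
  transitivity (\sum_(k <oo) \sum_(i < size s)
      ((a i)%:E * (if k \in K x then \d_(r k x, w k x) (B i) else 0))).
    apply: eq_eseriesr => k _; case: ifP => _; first exact: (decomp id).
    by rewrite big1// => i _; rewrite mule0.
  rewrite nneseries_sum; last first.
    by move=> i k _; apply: mule_ge0; [rewrite lee_fin ltW|case: ifP].
  apply: eq_bigr => i _; rewrite nneseriesZl; last by move=> k _; case: ifP.
  by rewrite /counting_points esum_nneseries.
rewrite (poisson_laplace_disjoint measurable_counting_points
  counting_points_count prm mB a0 tB).
have ea k : (0 <= 1 - expR (- a k))%R.
  by rewrite subr_ge0 -expR0 ler_expR oppr_le0 ltW.
rewrite -(expeRN_sum (size s)
  (u := fun k => (1 - expR (- a k))%:E * nu (B k))); last first.
  by move=> k; rewrite mule_ge0// lee_fin.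
congr (expeR (- _)).
transitivity (\int[nu]_p \sum_(k < size s) ((1 - expR (- a k))%:E * (\1_(B k) p)%:E)).
  rewrite ge0_integral_sum//; last 2 first.
  - move=> k; apply: measurable_funeM; apply/measurable_EFinP.
    exact: measurable_indic.
  - by move=> k p _; rewrite mule_ge0// lee_fin.
  apply: eq_bigr => k _; rewrite ge0_integralZl_EFin//.
  - by rewrite integral_indic// setIT.
  - by apply/measurable_EFinP; exact: measurable_indic.
by apply: eq_integral => p _; rewrite -(decomp (fun v => 1 - expR (- v))%R)// oppr0 expR0 subrr.
Qed.
End points.

Lemma measurable_fun_labelling d d' (T : measurableType d) (V : measurableType d')
    (c : nat -> V) (tau : T -> nat) :
  (forall t, measurable (tau @^-1` [set t])) ->
  measurable_fun setT (fun y => c (tau y)).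
Proof.
move=> mtau _ A mA; rewrite setTI.
rewrite (_ : _ @^-1` _ = \bigcup_(t in [set t | A (c t)]) tau @^-1` [set t]).
  by apply: bigcup_measurable => t _.
by apply/seteqP; split => [y /= Ay|y [t /= At ->]//]; exists (tau y).
Qed.

Section poisson_laplace_functional.
Local Open Scope ereal_scope.
Context {R : realType} {d} {T : measurableType d}.
Context {dS} {S : measurableType dS} (P : probability S R).
Variables (K : S -> set nat) (r : nat -> {mfun S >-> R}) (w : nat -> {mfun S >-> T}).
Hypothesis mK : forall k, measurable [set x | K x k].
Variable nu : {measure set (R * T) -> \bar R}.
Hypothesis prm : poisson_random_measure P nu (counting_points K r w).

Import HBNNSimple.

Lemma integral_expeRN_cvg (u : nat -> S -> \bar R) (v : S -> \bar R) :
  (forall n, measurable_fun setT (u n)) -> (forall n x, 0 <= u n x) ->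
  (forall x, u n x @[n --> \oo] --> v x) ->
  \int[P]_x expeR (- u n x) @[n --> \oo] --> \int[P]_x expeR (- v x).
Proof.
move=> mu u0 uv.
have v0 x : 0 <= v x.
  rewrite -(cvg_lim _ (uv x))//; apply: lime_ge; last exact: nearW.
  by apply/cvg_ex; exists (v x).
have mv : measurable_fun setT v.
  by apply: (emeasurable_fun_cvg u) => // x _.
have [] // := @dominated_convergence _ S R P setT measurableT
  (fun n x => expeR (- u n x)) (fun x => expeR (- v x)) (cst 1).
- by move=> n; exact: measurable_expeRN.
- exact: measurable_expeRN.
- by apply: aeW => x _; exact: cvg_expeRN.
- exact: finite_measure_integrable_cst.
- apply: aeW => x n _; rewrite gee0_abs ?expeR_ge0//; exact: expeRN_le1.
Qed.

(** Simple functions increase to f. On the left the exponentials are dominated by 1; on the right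
    the integrals increase, possibly to +oo, and [cvg_expeRN] covers that limit. *)
Lemma poisson_laplace (f : R * T -> R) :
  (forall p, 0 <= f p)%R -> measurable_fun setT f ->
  \int[P]_x expeR (- \esum_(k in K x) (f (r k x, w k x))%:E) =
  expeR (- \int[nu]_p (1 - expR (- f p))%:E).
Proof.
move=> f0 mf.
have mEf : measurable_fun setT (EFin \o f) by exact/measurable_EFinP.
pose h := nnsfun_approx measurableT mEf.
have hf p : (h n p)%:E @[n --> \oo] --> (f p)%:E.
  by apply: (cvg_nnsfun_approx measurableT mEf) => // q _; rewrite /= lee_fin.
have ndh p : nondecreasing_seq (fun n => h n p).
  by move=> m n mn; exact/lefP/nd_nnsfun_approx.
have h0 n p : (0 <= h n p)%R by exact: fun_ge0.
have lhs : \int[P]_x expeR (- \esum_(k in K x) (h n (r k x, w k x))%:E) @[n --> \oo]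
    --> \int[P]_x expeR (- \esum_(k in K x) (f (r k x, w k x))%:E).
  apply: integral_expeRN_cvg => [n|n x|x].
  - by apply: measurable_esum_points => //; exact: measurable_funPT.
  - by apply: esum_ge0 => k _; rewrite lee_fin.
  - exact: (esum_points_cvg (h := fun n p => h n p) h0 ndh hf).
have ge0 (v : R) : (0 <= v)%R -> (0 <= 1 - expR (- v))%R.
  by move=> v0; rewrite subr_ge0 -expR0 ler_expR oppr_le0.
have rhs : expeR (- \int[nu]_p (1 - expR (- h n p))%:E) @[n --> \oo]
    --> expeR (- \int[nu]_p (1 - expR (- f p))%:E).
  apply: cvg_expeRN.
    by move=> n; apply: integral_ge0 => p _; rewrite lee_fin ge0.
  have -> : \int[nu]_p (1 - expR (- f p))%:E =
      \int[nu]_p limn (fun n => (1 - expR (- h n p))%:E).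
    apply: eq_integral => p _; apply/esym/cvg_lim => //.
    apply: cvg_EFin; first exact: nearW.
    apply: cvgB; first exact: cvg_cst.
    apply: (continuous_cvg _ (@continuous_expR R _)); apply: cvgN.
    by have /fine_cvgP[] := hf p.
  apply: cvg_monotone_convergence => //.
  - move=> n; apply/measurable_EFinP; apply: measurable_funB => //.
    apply: measurableT_comp; first exact: measurable_expR.
    by apply: measurableT_comp => //; exact: measurable_funPT.
  - by move=> n p _; rewrite lee_fin ge0.
  - by move=> p _ m n mn; rewrite lee_fin lerD2l lerN2 ler_expR lerN2 ndh.
rewrite -(cvg_lim _ lhs)// -(cvg_lim _ rhs)//; congr (lim (_ @ \oo)).
by apply/funext => n; exact: poisson_laplace_simple.
Qed.

End poisson_laplace_functional.

(** * The Laplace exponent and the Lévy product measure *)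

Section levy.
Local Open Scope ereal_scope.
Context {R : realType}.
Variable rho : {measure set R -> \bar R}.

(** The function psi of the overview: the Laplace exponent of the driftless subordinator with Lévy
    measure [rho]. *)
Definition laplace_exponent (c : R) : \bar R :=
  \int[rho]_(s in `]0%R, +oo[) (1 - expR (- (c * s)))%:E.

Lemma exponentE : exponent rho = laplace_exponent 1.
Proof. by apply: eq_integral => s _; rewrite mul1r. Qed.

Lemma one_sub_expRN_ge0 (v : R) : (0 <= v)%R -> (0 <= 1 - expR (- v))%R.
Proof. by move=> v0; rewrite subr_ge0 -expR0 ler_expR oppr_le0. Qed.

Lemma measurable_one_sub_expRN d (S : measurableType d) D (f : S -> R) :
  measurable_fun D f -> measurable_fun D (fun x => (1 - expR (- f x))%:E : \bar R).
Proof.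
move=> mf; apply/measurable_EFinP; apply: measurable_funB => //.
apply: measurableT_comp; first exact: measurable_expR.
exact: measurable_funN.
Qed.

Lemma laplace_exponent_ge0 (c : R) : (0 <= c)%R -> 0 <= laplace_exponent c.
Proof.
move=> c0; apply: integral_ge0 => s /=; rewrite in_itv/= andbT => s0.
by rewrite lee_fin one_sub_expRN_ge0// mulr_ge0// ltW.
Qed.

Lemma laplace_exponent_le (c : R) : (0 <= c <= 1)%R ->
  laplace_exponent c <= exponent rho.
Proof.
move=> /andP[c0 c1]; apply: ge0_le_integral => //.
- move=> s /=; rewrite in_itv/= andbT => s0.
  by rewrite lee_fin one_sub_expRN_ge0// mulr_ge0// ltW.
- by apply: measurable_one_sub_expRN; exact: measurable_funM.
- exact: measurable_one_sub_expRN.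
- move=> s /=; rewrite in_itv/= andbT => s0.
  by rewrite lee_fin lerD2l lerN2 ler_expR lerN2 ler_piMl// ltW.
Qed.

(** The Laplace functional requires a test function that is nonnegative on the whole line, so s is
    replaced by max(s, 0). This changes nothing on (0, +oo), and elsewhere the integrand becomes
    0. *)
Lemma laplace_exponent_max (c : R) : (0 <= c)%R ->
  \int[rho]_s (1 - expR (- (c * Num.max s 0)))%:E = laplace_exponent c.
Proof.
move=> c0; rewrite /laplace_exponent [RHS]integral_mkcond; apply: eq_integral => s _.
rewrite patchE; case: ifPn => [/set_mem|/negP sn].
  by rewrite /= in_itv/= andbT => s0; rewrite max_l// ltW.
rewrite max_r ?mulr0 ?oppr0 ?expR0 ?subrr// leNgt; apply/negP => s0.
by apply: sn; rewrite inE /= in_itv/= s0.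
Qed.

Hypothesis rho_neg : rho `]-oo, 0%R]%classic = 0.
Hypothesis rho_fin : exponent rho < +oo.

(** [rho] may have infinite mass near 0. By Markov's inequality (1 - e^(-a)) rho[a, +oo) is at most
    the exponent; the half-lines with a = 1/n, n >= 1, and the null half-line up to 0 cover
    everything. Tonelli's theorem for the intensity rests on this. *)
Lemma levy_sigma_finite : sigma_finite setT rho.
Proof.
exists (fun n => if n is n'.+1 then `[(n'.+1%:R^-1)%R : R, +oo[%classic else `]-oo, 0%R]%classic).
  apply/seteqP; split => // s _; have [s0|s0] := leP s 0%R.
    by exists 0%N => //=; rewrite in_itv.
  have [n sn] : exists n : nat, (s^-1 < n%:R)%R.
    by exists (Num.bound s^-1); rewrite archi_boundP// invr_ge0 ltW.
  exists n.+1 => //=; rewrite in_itv/= andbT -[leRHS]invrK lef_pV2 ?posrE ?invr_gt0//.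
  by rewrite (le_trans (ltW sn))// ler_nat.
case=> [|n]; first by split => //; rewrite rho_neg.
split => //; set a := (n.+1%:R^-1)%R : R.
have a0 : (0 < a)%R by rewrite invr_gt0.
have e0 : (0 < 1 - expR (- a))%R by rewrite subr_gt0 -expR0 ltr_expR oppr_lt0.
have : (1 - expR (- a))%:E * rho `[a, +oo[%classic < +oo.
  apply: le_lt_trans rho_fin; rewrite -integral_cst//.
  apply: (@le_trans _ _ (\int[rho]_(s in `[a, +oo[) (1 - expR (- s))%:E)).
    apply: ge0_le_integral => //.
    - by move=> s _; rewrite lee_fin ltW.
    - exact: measurable_one_sub_expRN.
    - move=> s /=; rewrite in_itv/= andbT => sa.
      by rewrite lee_fin lerD2l lerN2 ler_expR lerN2.
  apply: ge0_subset_integral => //.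
  - exact: measurable_one_sub_expRN.
  - move=> s /=; rewrite in_itv/= andbT => s0.
    by rewrite lee_fin one_sub_expRN_ge0// ltW.
  - by move=> s /=; rewrite !in_itv/= !andbT; exact: lt_le_trans.
by case: (rho _) => [v| |]//; rewrite ?ltry// gt0_muley// lte_fin.
Qed.

Context {d} {T : measurableType d}.
Variable G0 : {finite_measure set T -> \bar R}.

Lemma integral_levy_product M (tau : T -> nat) (c : nat -> R) :
  labelling M tau -> (forall t, 0 <= c t)%R ->
  \int[(rho \x G0)]_p (1 - expR (- (c (tau p.2) * Num.max p.1 0)))%:E =
  \sum_(t < M) laplace_exponent (c t) * G0 (tau @^-1` [set (t : nat)]).
Proof.
move=> [mtau tauM] c0.
(* [rho] comes as a bare measure; its sigma-finiteness is packed locally, and integrating over s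
   before y makes psi appear. *)
pose H1 := isSFinite.Build _ _ _ _ (sfinite_measure_sigma_finite levy_sigma_finite).
pose H2 := isSigmaFinite.Build _ _ _ _ levy_sigma_finite.
pose rho' := HB.pack_for (SigmaFiniteMeasure.type R R) (Measure.sort rho) H1 H2.
pose g (p : R * T) : R := (c (tau p.2) * Num.max p.1 0)%R.
have g0 p : (0 <= g p)%R by rewrite mulr_ge0// le_max lexx orbT.
have mctau : measurable_fun setT (fun y : T => c (tau y)).
  exact: measurable_fun_labelling.
have mg : measurable_fun setT (fun p => (1 - expR (- g p))%:E : \bar R).
  apply: measurable_one_sub_expRN; apply: measurable_funM.
    by apply: (measurableT_comp mctau); exact: measurable_snd.
  by apply: measurable_maxr; [exact: measurable_fst|exact: measurable_cst].
have := @fubini_tonelli2 _ _ R T R rho' G0 _ mg (fun p => _).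
move=> ->; last by move=> p; rewrite lee_fin one_sub_expRN_ge0.
transitivity (\int[G0]_y laplace_exponent (c (tau y))).
  by apply: eq_integral => y _; rewrite /fubini_G -laplace_exponent_max.
transitivity (\int[G0]_y \sum_(t < M)
    (laplace_exponent (c t) * (\1_(tau @^-1` [set (t : nat)]) y)%:E)).
  apply: eq_integral => y _; rewrite (bigD1 (Ordinal (tauM y)))//= big1 ?adde0.
    by rewrite indicE mem_set// mule1.
  move=> t ty; rewrite indicE memNset ?mule0// => /= e.
  by move/eqP: ty; apply; apply: val_inj.
rewrite ge0_integral_sum//; last 2 first.
- move=> t; apply: measurable_funeM; apply/measurable_EFinP.
  exact: measurable_indic.
- by move=> t y _; rewrite mule_ge0 ?laplace_exponent_ge0// lee_fin.
apply: eq_bigr => t _; rewrite ge0_integralZl ?laplace_exponent_ge0//.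
- by rewrite integral_indic// setIT.
- by apply/measurable_EFinP; exact: measurable_indic.
Qed.

End levy.

(** * Mixed Poisson processes *)

Section labelled_points.
Local Open Scope ereal_scope.
Context {R : realType} {d} {T : measurableType d}.

(** A point lies in exactly one cell, so the sum over cells selects the coefficient of its label.
    The masses a k are the r k for G and the n k for the marked points. *)
Lemma labelled_esum (K : set nat) (a : nat -> R) (w : nat -> T) M (tau : T -> nat)
    (c : nat -> R) :
  (forall y, (tau y < M)%N) -> (forall k, K k -> 0 <= a k)%R ->
  (forall t, 0 <= c t)%R ->
  \sum_(t < M) ((c t)%:E *
    \esum_(k in K) ((a k)%:E * \d_(w k) (tau @^-1` [set (t : nat)]))) =
  \esum_(k in K) (c (tau (w k)) * a k)%:E.
Proof.
move=> tauM a0 c0.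
have F0 t k : K k -> 0 <= (a k)%:E * \d_(w k) (tau @^-1` [set (t : nat)]).
  by move=> Kk; rewrite mule_ge0// lee_fin a0.
have cF0 t k : K k ->
    0 <= (c t)%:E * ((a k)%:E * \d_(w k) (tau @^-1` [set (t : nat)])).
  by move=> Kk; apply: mule_ge0; [rewrite lee_fin|exact: F0].
transitivity (\sum_(t < M) \esum_(k in K)
    ((c t)%:E * ((a k)%:E * \d_(w k) (tau @^-1` [set (t : nat)])))).
  apply: eq_bigr => t _; rewrite (esum_nneseries (F0 t)) (esum_nneseries (cF0 t)).
  rewrite -nneseriesZl; last by move=> k _; case: ifPn => // /set_mem; exact: F0.
  by apply: eq_eseriesr => k _; case: ifP => // _; rewrite mule0.
rewrite -esum_sum; last by move=> k t Kk _; exact: cF0.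
apply: eq_esum => k Kk; rewrite (bigD1 (Ordinal (tauM (w k))))//= big1 ?adde0.
  by rewrite diracE mem_set// mule1 EFinM.
move=> t tk; rewrite diracE memNset ?mule0// => /= e.
by move/eqP: tk; apply; apply: val_inj.
Qed.

End labelled_points.

Section completely_random_measures.
Local Open Scope ereal_scope.
Context {R : realType} {d} {T : measurableType d}.
Context {dS} {S : measurableType dS} (P : probability S R).
Variables (rho : {measure set R -> \bar R}) (G0 : {finite_measure set T -> \bar R}).
Hypothesis rho_neg : rho `]-oo, 0%R]%classic = 0.
Hypothesis rho_fin : exponent rho < +oo.
Variables (K : S -> set nat) (r : nat -> {mfun S >-> R}) (w : nat -> {mfun S >-> T}).
Hypothesis G_crm : points_of_crm P K r w rho G0.

Let mK k : measurable [set x | K x k].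
Proof. by have [] := G_crm. Qed.

Let r_gt0 x k : K x k -> (0 < r k x)%R.
Proof. by have [_ + _] := G_crm; exact. Qed.

Lemma crm_laplace M (tau : T -> nat) (c : nat -> R) :
  labelling M tau -> (forall t, 0 <= c t)%R ->
  \int[P]_x expeR (- \esum_(k in K x) (c (tau (w k x)) * r k x)%:E) =
  expeR (- \sum_(t < M) laplace_exponent rho (c t) * G0 (tau @^-1` [set (t : nat)])).
Proof.
move=> lab c0; have [_ _ prm] := G_crm.
rewrite -(integral_levy_product rho_neg rho_fin G0 lab c0).
rewrite -(poisson_laplace mK prm); last 2 first.
- by move=> p; rewrite mulr_ge0// le_max lexx orbT.
- apply: measurable_funM.
    apply: (measurableT_comp (measurable_fun_labelling c lab.1)).
    exact: measurable_snd.
  by apply: measurable_maxr; [exact: measurable_fst|exact: measurable_cst].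
apply: eq_integral => x _; congr (expeR (- _)); apply: eq_esum => k Kk /=.
by rewrite max_l// ltW// r_gt0.
Qed.

Lemma weighted_points_ge0 x A : 0 <= weighted_points K r w x A.
Proof.
by apply: esum_ge0 => k Kk; rewrite mule_ge0// lee_fin ltW// r_gt0.
Qed.

Lemma measurable_weighted_points A : measurable A ->
  measurable_fun setT (fun x => weighted_points K r w x A).
Proof.
move=> mA; apply: measurable_point_sum => // [k|k x Kk].
  apply: emeasurable_funM; first by apply/measurable_EFinP; exact: measurable_funPT.
  apply: (measurableT_comp (measurable_fun_dirac mA)); exact: measurable_funPT.
by rewrite mule_ge0// lee_fin ltW// r_gt0.
Qed.

(** A single formula covers all values of f: at +oo its exponential factor is 0, as is the mass of a
    finite count. *)
Lemma measurable_ePo d' (U : measurableType d') (f : U -> \bar R) j :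
  (forall x, 0 <= f x) -> measurable_fun setT f ->
  measurable_fun setT (fun x => (ePo (f x) (Some j))%:E : \bar R).
Proof.
move=> f0 mf; rewrite (_ : (fun x => _) = fun x =>
    expeR (- f x) * ((fine (f x)) ^+ j / j`!%:R)%:E).
  apply: emeasurable_funM; first exact: measurable_expeRN.
  apply/measurable_EFinP; apply: measurable_funM => //.
  by apply: measurable_funX; exact: measurableT_comp.
apply/funext => x; have := f0 x; case: (f x) => [v| |]//= _.
  by rewrite -EFinM /Po mulrA.
by rewrite mul0e.
Qed.

(** In [integral_prod_mixture] the mass functions q are random here: Poisson masses with mean
    [G x (B t)]. Summed against z ^ j they give e^(-(1 - z) G(B t)), to which [crm_laplace]
    applies. *)
Lemma mixed_poisson_gen_fun (X : S -> set T -> \bar R) M (tau : T -> nat)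
    (z : nat -> R) :
  (forall A, measurable A -> measurable_fun setT (X ^~ A)) ->
  mixed_poisson P (weighted_points K r w) X ->
  labelling M tau -> (forall t, 0 < z t < 1)%R ->
  \int[P]_x \prod_(t < M) pow (z t) (to_count (X x (tau @^-1` [set (t : nat)]))) =
  expeR (- \sum_(t < M) laplace_exponent rho (1 - z t) * G0 (tau @^-1` [set (t : nat)])).
Proof.
move=> mX X_mp lab z01; have [mtau tauM] := lab.
have z0 t : (0 <= z t)%R by case/andP: (z01 t) => /ltW.
have z1 t : (0 <= 1 - z t)%R by rewrite subr_ge0; case/andP: (z01 t) => _ /ltW.
pose B t := tau @^-1` [set t].
rewrite -(crm_laplace lab z1).
transitivity (\int[P]_x (1 * \prod_(t < M)
    oapp (fun j => (z t ^+ j)%:E) 0 (to_count (X x (B t))))).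
  by apply: eq_integral => x _; rewrite mul1e.
rewrite (@integral_prod_mixture _ _ _ _ _ 0%N M (fun=> 1) (fun=> 1)
  (fun t x => to_count (X x (B t)))
  (fun t j x => (ePo (weighted_points K r w x (B t)) (Some j))%:E)
  (fun t j => (z t ^+ j)%:E))//.
- apply: eq_integral => x _; rewrite mul1e.
  rewrite -(@labelled_esum R _ T (K x) (r^~ x) (w^~ x) M tau (fun t => 1 - z t)%R)//; last by move=> k Kk; rewrite ltW// r_gt0.
  rewrite (expeRN_sum M (u := fun t => (1 - z t)%:E * weighted_points K r w x (B t))); last first.
    by move=> t; rewrite mule_ge0 ?lee_fin// weighted_points_ge0.
  apply: eq_bigr => t _; rewrite -nneseries_esumT; last first.
    by move=> j; rewrite mule_ge0// lee_fin ?ePo_ge0 ?weighted_points_ge0// exprn_ge0.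
  apply: ePo_gen_fun; first exact: weighted_points_ge0.
  by rewrite z0; case/andP: (z01 t).
- by move=> t j; apply: measurable_to_count; exact: (mX _ (mtau t)).
- move=> t j; apply: measurable_ePo; first by move=> x; exact: weighted_points_ge0.
  exact: (measurable_weighted_points (mtau t)).
- by move=> t j x; rewrite lee_fin ePo_ge0// weighted_points_ge0.
- by move=> t j; rewrite lee_fin exprn_ge0.
move=> c.
transitivity (P (setT `&`
    [set x | forall t, (t < M)%N -> to_count (X x (B t)) = Some (c t)])).
  rewrite -integral_prod_delta//; last first.
    by move=> k j; apply: measurable_to_count; exact: (mX _ (mtau k)).
  by apply: eq_integral => x _; rewrite indicT.
(* Over the full event the conditional mass function averages to the law of X. *)
have sT : @eval_sigma R d T setT.
  have [s0 sC _] := smallest_sigma_algebra setT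
    (\bigcup_(A in [set A : set T | measurable A])
        preimage_set_system setT (fun mu : set T -> \bar R => mu A) measurable).
  by have := sC _ s0; rewrite setD0.
have := X_mp setT M (fun i : 'I_M => B i) (fun i : 'I_M => Some (c i)) sT (fun i => mtau i).
rewrite preimage_setT (_ : [set x | _] =
    [set x | forall t, (t < M)%N -> to_count (X x (B t)) = Some (c t)]); last first.
  apply/seteqP; split => x /= h.
    by move=> k km; apply/to_countP; exact: (h (Ordinal km)).
  by move=> [k km]; apply/to_countP; exact: h.
move=> ->; first by apply: eq_integral => x _; rewrite mul1e prodEFin.
by move=> i j _ _ [y [/= yi yj]]; apply: val_inj; rewrite /= -yi -yj.
Qed.

End completely_random_measures.

(** * Points carrying integer marks *)

Section marked_points.
Local Open Scope ereal_scope.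
Context {R : realType} {d} {T : measurableType d} {dS} {S : measurableType dS}.
Variables (K : S -> set nat) (w : nat -> {mfun S >-> T}) (n : nat -> {mfun S >-> nat}).
Hypothesis mK : forall k, measurable [set x | K x k].

Local Notation X := (@marked_points R d T dS S K w n).

Lemma additive_marked_points x : additive_set_fun (X x).
Proof.
split; first by apply: esum1 => k _; rewrite dirac0 mule0.
move=> A B mA mB AB0; rewrite /marked_points -esumD; last 2 first.
- by move=> k _; rewrite mule_ge0.
- by move=> k _; rewrite mule_ge0.
apply: eq_esum => k _; rewrite -ge0_muleDr//; congr (_ * _).
rewrite !diracE in_setU; case: (boolP (w k x \in A)) => [/set_mem wA|_].
  rewrite memNset ?adde0// => wB.
  by have : (A `&` B) (w k x) by []; rewrite AB0.
by rewrite add0e.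
Qed.

Lemma measurable_fun_count (f : {mfun S >-> nat}) (c : nat -> R) : measurable_fun setT (fun x => c (f x)).
Proof.
apply: measurable_fun_labelling => t.
by rewrite -[X in measurable X]setTI; exact: measurable_funPT.
Qed.

Lemma measurable_marked_points A : measurable A -> measurable_fun setT (X ^~ A).
Proof.
move=> mA; apply: measurable_point_sum => // [k|k x _]; last by rewrite mule_ge0.
apply: emeasurable_funM.
  apply/measurable_EFinP; exact: (measurable_fun_count (n k) (fun j => j%:R)%R).
by apply: (measurableT_comp (measurable_fun_dirac mA)); exact: measurable_funPT.
Qed.

Lemma marked_points_count x A : X x A = +oo \/ exists j : nat, X x A = j%:R%:E.
Proof.
rewrite /marked_points esum_nneseries; last by move=> k _; rewrite mule_ge0.
have E : \sum_(k <oo) (if k \in K x then (n k x)%:R%:E * \d_(w k x) A else 0) =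
    \sum_(k <oo) (if k \in K x then n k x * ((w k x) \in A) else 0)%N%:R%:E :> \bar R.
  by apply: eq_eseriesr => k _; case: ifP => // _; rewrite natrM EFinM diracE.
rewrite E; exact: nat_series_count.
Qed.

(** With a = - ln z > 0 the product over cells is the exponential of one sum over points. K is
    arbitrary, so the compound process, with index set {k < l x}, is covered too. *)
Lemma prod_pow_marked_points M (tau : T -> nat) (z : nat -> R) x :
  labelling M tau -> (forall t, 0 < z t < 1)%R ->
  \prod_(t < M) pow (z t) (to_count (X x (tau @^-1` [set (t : nat)]))) =
  expeR (- \esum_(k in K x) (- ln (z (tau (w k x))) * (n k x)%:R)%:E).
Proof.
move=> [mtau tauM] z01.
have z0 t : (0 < z t)%R by case/andP: (z01 t).
have lnz t : (0 < - ln (z t))%R.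
  by rewrite oppr_gt0 ln_lt0//; exact: z01.
rewrite -(@labelled_esum R _ T (K x) (fun k => (n k x)%:R)%R (w^~ x) M tau
  (fun t => - ln (z t))%R)//; last by move=> t; exact: ltW.
rewrite (expeRN_sum M (u := fun t => (- ln (z t))%:E * X x (tau @^-1` [set t]))); last first.
  move=> t; apply: mule_ge0; first by rewrite lee_fin ltW.
  by apply: esum_ge0 => k _; rewrite mule_ge0.
apply: eq_bigr => t _; rewrite -pow_expR//; last exact: marked_points_count.
by rewrite opprK lnK// posrE.
Qed.

End marked_points.

Section poisson_marks.
Local Open Scope ereal_scope.
Context {R : realType} {d} {T : measurableType d}.
Context {dS} {S : measurableType dS} (P : probability S R).
Variables (K : S -> set nat) (r : nat -> {mfun S >-> R})
  (w : nat -> {mfun S >-> T}) (n : nat -> {mfun S >-> nat}).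
Hypothesis mK : forall k, measurable [set x | K x k].
Hypothesis r_gt0 : forall x k, K x k -> (0 < r k x)%R.
Hypothesis n_marks : poisson_marks P K r w n.
Variables (M : nat) (tau : T -> nat) (z : nat -> R).
Hypothesis lab : labelling M tau.
Hypothesis z01 : forall t, (0 < z t < 1)%R.

Let z0 t : (0 < z t)%R.
Proof. by case/andP: (z01 t). Qed.

Let mtauw k t : measurable [set x | tau (w k x) = t].
Proof.
rewrite -[X in measurable X]setTI.
exact: (measurable_funPT (w k) measurableT _ (lab.1 t)).
Qed.

(** The outcome at index k: label and count, or [None] for an absent index. Absence is a genuine
    outcome, not the junk one of [integral_prod_mixture]; hence the outer [Some] put around [mark]
    below. *)
Let mark k x : option (nat * nat) :=
  if `[< K x k >] then Some (tau (w k x), n k x) else None.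

Let label_is (o : option (nat * nat)) k : set S :=
  if o is Some (t, _) then [set x | K x k /\ tau (w k x) = t]
  else [set x | ~ K x k].

(** The conditional probability, given the points, of the outcome o: presence and label are already
    decided by the points, the count is Poisson. *)
Let mark_prob k (o : option (nat * nat)) x : \bar R :=
  (if o is Some (_, j) then Po (r k x) j else 1%R)%:E * (\1_(label_is o k) x)%:E.

Let mark_fun (o : option (nat * nat)) : \bar R :=
  if o is Some (t, j) then (z t ^+ j)%:E else 1.

Let measurable_label_is o k : measurable (label_is o k).
Proof.
case: o => [[t j]|]; last exact: (measurableC (mK k)).
exact: (measurableI _ _ (mK k) (mtauw k t)).
Qed.

(** Presence and label are functions of the points, so their values can be prescribed in the
    conditioning event of [poisson_marks]. *)
Let points_sigma_label_is m (c : nat -> option (nat * nat)) :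
  points_sigma K r w [set x | forall k, (k < m)%N -> label_is (c k) k x].
Proof.
pose gen := [set E | exists k : nat, exists2 B : set (R * T), measurable B &
  E = [set x | K x k /\ B (r k x, w k x)] ].
apply: (@measurable_forall_ltn _ (g_sigma_algebraType gen) m
  (fun k => label_is (c k) k)) => k.
case: (c k) => [[t j]|].
  apply: sub_sigma_algebra; exists k, (snd @^-1` (tau @^-1` [set t])) => //.
  rewrite -[X in measurable X]setTI.
  exact: (measurable_snd measurableT _ (lab.1 t)).
apply: measurableC; apply: sub_sigma_algebra; exists k, setT => //.
by apply/seteqP; split => x //= [].
Qed.

(** The event splits into E, which concerns the points, and the counts at present indices. On E the
    choice c decides which indices below m are present. *)
Let mark_law m (c : nat -> option (nat * nat)) :
  \int[P]_x (1 * \prod_(k < m) (Some (mark k x) == Some (c k))%:R%:E) =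
  \int[P]_x (1 * \prod_(k < m) mark_prob k (c k) x).
Proof.
pose E := [set x | forall k, (k < m)%N -> label_is (c k) k x].
have mE : measurable E.
  by apply: (@measurable_forall_ltn _ _ m (fun k => label_is (c k) k)).
(* The value 0 is junk: on E such an index is absent and its count is not constrained. *)
pose j k := if c k is Some (_, j) then j else 0%N.
transitivity (P (E `&` [set x | forall k, (k < m)%N -> K x k -> n k x = j k])).
  transitivity (\int[P]_x (\1_(E `&`
      [set x | forall k, (k < m)%N -> K x k -> n k x = j k]) x)%:E).
    apply: eq_integral => x _; rewrite mul1e.
    rewrite (prod_delta m (fun k => Some (mark k x))) indicE.
    congr (nat_of_bool _)%:R%:E; apply/asboolP/idP.
      move=> h; apply/mem_set; split => k km; have := h k km; rewrite /mark/label_is/j.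
        by case: asboolP => [Kk|nK] [<-].
      by case: asboolP => [Kk|nK] [<-].
    move=> /set_mem[Ex hx] k km; have := Ex k km; have := hx k km.
    rewrite /mark/label_is/j; case: (c k) => [[t i]|].
      by move=> ni [Kk tk]; rewrite asboolT// tk ni.
    by move=> _ nK; rewrite asboolF.
  rewrite integral_indic ?setIT//; apply: measurableI => //.
  apply: (@measurable_forall_ltn _ _ m (fun k => [set x | K x k -> n k x = j k])) => k.
  rewrite (_ : [set x | _] = ~` [set x | K x k] `|` n k @^-1` [set j k]).
    apply: measurableU; first exact: (measurableC (mK k)).
    by rewrite -[X in measurable X]setTI; exact: measurable_funPT.
  apply/seteqP; split => x /=; last by case.
  by move=> h; have [Kk|nK] := pselect (K x k); [right; exact: h|left].
rewrite n_marks; last exact: points_sigma_label_is.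
rewrite integral_mkcond; apply: eq_integral => x _; rewrite mul1e patchE.
case: ifPn => [/set_mem Ex|/negP nEx].
  rewrite big_mkcond/= -prodEFin; apply: eq_bigr => k _.
  have := Ex k (ltn_ord k); rewrite /mark_prob/j indicE.
  case: (c k) => [[t i]|] /= h; rewrite mem_set// mule1.
    by rewrite asboolT//; case: h.
  by rewrite asboolF.
(* Off E some indicator in the product is 0. *)
have /existsNP[k /not_implyP[km nk]] : ~ forall k, (k < m)%N -> label_is (c k) k x.
  by move=> h; apply: nEx; apply/mem_set.
rewrite (bigD1 (Ordinal km))//= {1}/mark_prob indicE memNset ?mule0 ?mul0e//.
Qed.

(** Outcomes with positive conditional mass have the actual label, which leaves the generating
    function of Po(r k), or are [None], with mass 1, when the index is absent. *)
Let esum_mark k x : \esum_(o in [set: option (nat * nat)])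
    (mark_fun o * mark_prob k o x) =
  if `[< K x k >] then (expR (- ((1 - z (tau (w k x))) * r k x)))%:E else 1.
Proof.
have esum_supp (A : set (option (nat * nat))) (F : option (nat * nat) -> \bar R) :
    (forall o, ~ A o -> F o = 0) ->
    \esum_(o in [set: option (nat * nat)]) F o = \esum_(o in A) F o.
  move=> F0; rewrite [RHS]esum_mkcond; apply: eq_esum => o _.
  by case: ifPn => // /negP h; apply: F0 => Ao; apply: h; exact/mem_set.
case: asboolP => [Kk|nK].
  rewrite (esum_supp ((fun j => Some (tau (w k x), j)) @` [set: nat])).
    rewrite esum_image; last by move=> i j _ _ [].
    rewrite -nneseries_esumT.
      rewrite -Po_gen_fun ?ltW ?r_gt0//; apply: eq_eseriesr => j _.
      by rewrite /mark_fun/mark_prob indicE mem_set ?mule1.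
    move=> j; rewrite mule_ge0//; first by rewrite lee_fin exprn_ge0 ?ltW.
    by rewrite mule_ge0// ?lee_fin// Po_ge0 ?ltW ?r_gt0.
  move=> [[t j]|] h; rewrite /mark_prob indicE memNset ?mule0//.
  by move=> [_ /= e]; apply: h; exists j => //; rewrite e.
rewrite (esum_supp [set None]).
  by rewrite esum_set1 /mark_fun/mark_prob indicE mem_set// ?mul1e.
move=> [[t j]|] h; last by exfalso; apply: h.
by rewrite /mark_prob indicE memNset ?mule0//= => -[].
Qed.

Lemma finite_poisson_marks m :
  \int[P]_x expeR (- \sum_(k < m)
    (if (k : nat) \in K x then (- ln (z (tau (w k x))) * (n k x)%:R)%:E else 0)) =
  \int[P]_x expeR (- \sum_(k < m)
    (if (k : nat) \in K x then ((1 - z (tau (w k x))) * r k x)%:E else 0)).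
Proof.
transitivity (\int[P]_x (1 * \prod_(k < m) oapp mark_fun 0 (Some (mark k x)))).
  apply: eq_integral => x _; rewrite mul1e.
  rewrite (expeRN_sum m (u := fun k => if k \in K x then
    (- ln (z (tau (w k x))) * (n k x)%:R)%:E else 0)); last first.
    move=> k; case: ifP => // _; rewrite lee_fin mulr_ge0// oppr_ge0 ln_le0//.
    by rewrite ltW//; case/andP: (z01 (tau (w k x))).
  apply: eq_bigr => k _; rewrite /= /mark -[`[< _ >]]/((k : nat) \in K x).
  case: ifP => _ /=; last by rewrite oppr0 expR0.
  by rewrite mulNr opprK mulrC expRM_natl lnK// posrE.
rewrite (@integral_prod_mixture _ _ _ _ _ None m (fun=> 1) (fun=> 1)
  (fun k x => Some (mark k x)) mark_prob (fun=> mark_fun))//.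
- apply: eq_integral => x _; rewrite mul1e.
  rewrite (expeRN_sum m (u := fun k => if k \in K x then
    ((1 - z (tau (w k x))) * r k x)%:E else 0)); last first.
    move=> k; case: ifP => // /set_mem Kk; rewrite lee_fin mulr_ge0 ?subr_ge0//.
      by rewrite ltW//; case/andP: (z01 (tau (w k x))).
    by rewrite ltW// r_gt0.
  apply: eq_bigr => k _; rewrite esum_mark -[`[< _ >]]/((k : nat) \in K x).
  by case: ifP => //= _; rewrite oppr0 expR0.
- move=> k o; rewrite (_ : [set x | _] = label_is o k `&`
      (if o is Some (_, j) then n k @^-1` [set j] else setT)).
    apply: measurableI => //; case: o => [[t j]|//].
    by rewrite -[X in measurable X]setTI; exact: measurable_funPT.
  apply/seteqP; split => x; rewrite /mark /=.
    by case: asboolP => Kk [<-].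
  case: o => [[t j]|] /= [].
    by move=> [Kk <-] <-; rewrite asboolT.
  by move=> nK _; rewrite asboolF.
- move=> k o; apply: emeasurable_funM; last first.
    by apply/measurable_EFinP; exact: measurable_indic.
  apply/measurable_EFinP; case: o => [[t j]|//].
  apply: measurable_funM => //; apply: measurable_funM.
    apply: measurableT_comp; first exact: measurable_expR.
    by apply: measurable_funN; exact: measurable_funPT.
  by apply: measurable_funX; exact: measurable_funPT.
- move=> k o x; rewrite /mark_prob indicE.
  have [/set_mem|_] := boolP (x \in label_is o k); last by rewrite mule0.
  rewrite mule1; case: o => [[t j]|_] //= [Kk _].
  by rewrite lee_fin Po_ge0// ltW// r_gt0.
- by move=> _ [[t j]|]; rewrite /mark_fun ?lee01// lee_fin exprn_ge0// ltW.
Qed.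

(** The law of the marks is given for the indices below m; dominated convergence lets m tend to
    infinity on both sides. *)
Lemma poisson_marks_gen_fun :
  \int[P]_x \prod_(t < M) pow (z t)
    (to_count (R := R) (marked_points K w n x (tau @^-1` [set (t : nat)]))) =
  \int[P]_x expeR (- \esum_(k in K x) ((1 - z (tau (w k x))) * r k x)%:E).
Proof.
have cvg (F : nat -> S -> \bar R) : (forall k, measurable_fun setT (F k)) ->
    (forall k x, K x k -> 0 <= F k x) ->
    \int[P]_x expeR (- \sum_(k < m) (if (k : nat) \in K x then F k x else 0)) @[m --> \oo]
    --> \int[P]_x expeR (- \esum_(k in K x) F k x).
  move=> mF F0.
  have G0 k x : 0 <= (if k \in K x then F k x else 0).
    by case: ifPn => // /set_mem; exact: F0.
  apply: integral_expeRN_cvg => [m|m x|x].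
  - by apply: emeasurable_sum => k; exact: measurable_fun_if_mem.
  - by apply: sume_ge0 => k _; exact: G0.
  rewrite esum_nneseries; last by move=> k; exact: F0.
  under eq_fun do rewrite -(big_mkord xpredT (fun k => if k \in K x then F k x else 0)).
  exact: is_cvg_nneseries.
under eq_integral do rewrite (prod_pow_marked_points _ _ _ _ lab z01).
have mc (g : nat -> R) k : measurable_fun setT (fun x => g (tau (w k x))).
  by apply: measurable_fun_labelling => t; exact: mtauw.
have lhs := cvg (fun k x => (- ln (z (tau (w k x))) * (n k x)%:R)%:E) _ _.
have rhs := cvg (fun k x => ((1 - z (tau (w k x))) * r k x)%:E) _ _.
rewrite -(cvg_lim _ (lhs _ _))//; last 2 first.
- move=> k; apply/measurable_EFinP; apply: measurable_funM.
    exact: (mc (fun t => - ln (z t))%R).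
  exact: (measurable_fun_count (n k) (fun j => j%:R)%R).
- move=> k x _; rewrite lee_fin mulr_ge0// oppr_ge0 ln_le0//.
  by rewrite ltW//; case/andP: (z01 (tau (w k x))).
rewrite -(cvg_lim _ (rhs _ _))//; last 2 first.
- move=> k; apply/measurable_EFinP; apply: measurable_funM.
    exact: (mc (fun t => 1 - z t)%R).
  exact: measurable_funPT.
- move=> k x Kk; rewrite lee_fin mulr_ge0 ?subr_ge0//.
    by rewrite ltW//; case/andP: (z01 (tau (w k x))).
  by rewrite ltW// r_gt0.
by congr (lim (_ @ \oo)); apply/funext => m; exact: finite_poisson_marks.
Qed.

End poisson_marks.

(** * Compound Poisson processes *)

Section jump_distribution.
Local Open Scope ereal_scope.
Context {R : realType}.
Variable rho : {measure set R -> \bar R}.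
Hypothesis rho_neg : rho `]-oo, 0%R]%classic = 0.
Hypothesis rho_neq0 : rho setT != 0.
Hypothesis rho_fin : exponent rho < +oo.

Local Notation Rpos := (`]0%R, +oo[%classic : set R).
Local Notation e := (fine (exponent rho)).
Local Notation psi := (laplace_exponent rho).

Lemma exponent_fin_num : exponent rho \is a fin_num.
Proof. by rewrite ge0_fin_numE// exponentE laplace_exponent_ge0. Qed.

Lemma laplace_exponent_fin_num (c : R) : (0 <= c <= 1)%R -> psi c \is a fin_num.
Proof.
move=> c01; have /andP[c0 _] := c01.
rewrite ge0_fin_numE; last exact: laplace_exponent_ge0.
exact: le_lt_trans (laplace_exponent_le rho c01) rho_fin.
Qed.

(** 1 - e^(-s) is positive for s > 0, so a zero integral would make [rho] null on (0, +oo), hence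
    zero. *)
Lemma exponent_gt0 : (0 < e)%R.
Proof.
rewrite fine_gt0// rho_fin andbT lt0e exponentE laplace_exponent_ge0// andbT.
apply/eqP => psi0.
have : \int[rho]_(s in `]0%R, +oo[) `|(1 - expR (- (1 * s)))%:E| = 0.
  rewrite -[RHS]psi0; apply: eq_integral => s /set_mem h.
  have s0 : (0 < s)%R by move: h; rewrite /= in_itv/= andbT.
  rewrite gee0_abs// lee_fin.
  by rewrite one_sub_expRN_ge0// mul1r ltW.
have mf : measurable_fun Rpos (fun s : R => (1 - expR (- (1 * s)))%:E : \bar R).
  by apply: measurable_one_sub_expRN; exact: measurable_funM.
move/(ae_eq_integral_abs rho _ mf) => -[]// N [mN N0 sub].
have pos0 : rho Rpos = 0.
  apply/eqP; rewrite eq_le measure_ge0 andbT -N0 le_measure ?inE//.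
  move=> s /= s0; apply: sub => /= /(_ s0) [].
  move/eqP; rewrite subr_eq0 eq_sym mul1r -[X in _ == X]expR0 (inj_eq (@expR_inj R)) oppr_eq0.
  by move: s0; rewrite in_itv/= andbT => /gt_eqF ->.
move/eqP : rho_neq0; apply.
rewrite (_ : setT = `]-oo, 0%R]%classic `|` Rpos).
  transitivity (rho `]-oo, 0%R]%classic + rho Rpos); last first.
    by rewrite rho_neg pos0 adde0.
  apply: measureU => //.
  by apply/seteqP; split => // s /=; rewrite !in_itv/= andbT leNgt => -[/negbTE ->].
by apply/seteqP; split => // s _ /=; rewrite !in_itv/= andbT; case: leP; [left|right].
Qed.

(** The masses of Po(s) mixed over [rho], restricted to positive counts and normalised. At 0 the
    formula of [jump_pmf] would involve the integral of e^(-s), which can be infinite. *)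
Definition jump_prob (j : nat) : R := if j is 0%N then 0%R else jump_pmf rho j.

Lemma measurable_Po (f g : R -> R) D j : measurable_fun D f -> measurable_fun D g ->
  measurable_fun D (fun s => (f s ^+ j / j`!%:R * expR (- g s))%:E : \bar R).
Proof.
move=> mf mg; apply/measurable_EFinP; apply: measurable_funM.
  by apply: measurable_funM => //; exact: measurable_funX.
by apply: measurableT_comp; [exact: measurable_expR|exact: measurable_funN].
Qed.

Lemma Po_term_ge0 (c s : R) j : (0 <= c)%R -> Rpos s ->
  0 <= ((c * s) ^+ j / j`!%:R * expR (- s))%:E :> \bar R.
Proof.
move=> c0; rewrite /= in_itv/= andbT => s0.
by rewrite lee_fin mulr_ge0 ?expR_ge0// mulr_ge0 ?invr_ge0// exprn_ge0// mulr_ge0// ltW.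
Qed.

(** The integral is finite, and [fine] in [jump_pmf] harmless, because 1 + s^k / k! <= e^s for k = j
    + 1, i.e. s^k / k! e^(-s) <= 1 - e^(-s). *)
Lemma jump_moment j :
  (e * jump_prob j.+1)%:E =
  \int[rho]_(s in `]0%R, +oo[) (s ^+ j.+1 / j.+1`!%:R * expR (- s))%:E.
Proof.
have F0 : (0 < j.+1`!%:R :> R)%R by rewrite ltr0n fact_gt0.
have mf : measurable_fun Rpos
    (fun s : R => (s ^+ j.+1 * expR (- s))%:E : \bar R).
  apply/measurable_EFinP; apply: measurable_funM; first exact: measurable_funX.
  by apply: measurableT_comp; [exact: measurable_expR|exact: measurable_funN].
have f0 s : Rpos s -> 0 <= (s ^+ j.+1 * expR (- s))%:E :> \bar R.
  rewrite /= in_itv/= andbT => s0.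
  by rewrite lee_fin mulr_ge0 ?expR_ge0// exprn_ge0// ltW.
have scale : \int[rho]_(s in `]0%R, +oo[) (s ^+ j.+1 / j.+1`!%:R * expR (- s))%:E =
    (j.+1`!%:R^-1)%:E * \int[rho]_(s in `]0%R, +oo[) (s ^+ j.+1 * expR (- s))%:E.
  rewrite -ge0_integralZl_EFin//.
  by apply: eq_integral => s _; rewrite -EFinM mulrA [(_^-1 * _)%R]mulrC.
have fin : \int[rho]_(s in `]0%R, +oo[) (s ^+ j.+1 * expR (- s))%:E \is a fin_num.
  have : (j.+1`!%:R^-1)%:E * \int[rho]_(s in `]0%R, +oo[) (s ^+ j.+1 * expR (- s))%:E < +oo.
    rewrite -scale (le_lt_trans _ rho_fin)//; apply: ge0_le_integral => //.
    - move=> s /=; rewrite in_itv/= andbT => s0.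
      by rewrite lee_fin mulr_ge0 ?expR_ge0// mulr_ge0 ?invr_ge0// exprn_ge0// ltW.
    - exact: measurable_Po.
    - exact: measurable_one_sub_expRN.
    - move=> s /=; rewrite in_itv/= andbT => s0; rewrite lee_fin.
      rewrite -ler_pdivlMr ?expR_gt0// expRN invrK mulrBl mul1r mulVf ?gt_eqF ?expR_gt0//.
      by rewrite lerBrDl expR_ge1Dxn// ltW.
  have := integral_ge0 rho f0.
  by case: integral => [v| |]//; rewrite gt0_muley// lte_fin invr_gt0.
rewrite scale -(fineK fin) -EFinM; congr _%:E.
rewrite /jump_prob /jump_pmf invfM [LHS]mulrC -!mulrA mulVf ?mulr1.
  by rewrite mulrC.
by rewrite gt_eqF// exponent_gt0.
Qed.

Lemma jump_prob_ge0 j : (0 <= jump_prob j)%R.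
Proof.
case: j => [//|j].
rewrite -(pmulr_rge0 _ exponent_gt0) -lee_fin jump_moment.
apply: integral_ge0 => s /=; rewrite in_itv/= andbT => s0.
by rewrite lee_fin mulr_ge0 ?expR_ge0// mulr_ge0 ?invr_ge0// exprn_ge0// ltW.
Qed.

(** Summation under the integral sign, then e^(-s) (e^(z s) - 1) + (1 - e^(-(1 - z) s)) = 1 -
    e^(-s). *)
Lemma jump_gen_fun (z : R) : (0 <= z <= 1)%R ->
  \sum_(j <oo) ((z ^+ j)%:E * (jump_prob j)%:E) = ((e - fine (psi (1 - z))) / e)%:E.
Proof.
move=> z01; have /andP[z0 z1] := z01; have e0 := exponent_gt0.
have z1' : (0 <= 1 - z <= 1)%R by rewrite subr_ge0 z1 gerBl z0.
have psi_fin := laplace_exponent_fin_num z1'.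
(* As a sum of nonnegative terms, the identity follows from additivity and Tonelli without
   subtracting integrals. *)
suff H : e%:E * \sum_(j <oo) ((z ^+ j)%:E * (jump_prob j)%:E) + psi (1 - z) = e%:E.
  have : e%:E * \sum_(j <oo) ((z ^+ j)%:E * (jump_prob j)%:E) =
      (e - fine (psi (1 - z)))%:E.
    move/(congr1 (fun x => x - psi (1 - z))) : H; rewrite (addeK _ psi_fin) => ->.
    by rewrite -{1}(fineK psi_fin) -EFinB.
  move=> /(congr1 (fun x => (e^-1)%:E * x)); rewrite muleA -!EFinM mulVf ?gt_eqF//.
  by rewrite mul1e mulrC.
have p0 j : 0 <= (z ^+ j)%:E * (jump_prob j)%:E.
  by rewrite mule_ge0// lee_fin ?exprn_ge0// jump_prob_ge0.
rewrite nneseries_recl1// mule0 add0e -nneseriesZl//.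
transitivity (\sum_(j <oo) \int[rho]_(s in `]0%R, +oo[)
    ((z * s) ^+ j.+1 / j.+1`!%:R * expR (- s))%:E + psi (1 - z)).
  congr (_ + _); apply: eq_eseriesr => j _.
  rewrite muleCA -(EFinM e) jump_moment -ge0_integralZl_EFin//.
  - by apply: eq_integral => s _; rewrite -EFinM exprMn !mulrA.
  - by move=> s /(Po_term_ge0 j.+1 ler01); rewrite mul1r.
  - exact: measurable_Po.
  - by rewrite exprn_ge0.
have mzs j : measurable_fun Rpos
    (fun s : R => ((z * s) ^+ j.+1 / j.+1`!%:R * expR (- s))%:E : \bar R).
  by apply: measurable_Po => //; exact: measurable_funM.
rewrite -integral_nneseries//; last by move=> j s; exact: Po_term_ge0.
rewrite -ge0_integralD//; last 4 first.
- by move=> s s0; apply: nneseries_ge0 => j _ _; exact: Po_term_ge0.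
- rewrite (_ : (fun s => _) = fun s => \sum_(j <oo | j \in xpredT)
      ((z * s) ^+ j.+1 / j.+1`!%:R * expR (- s))%:E)//.
  by apply: ge0_emeasurable_sum => // j s s0 _; exact: Po_term_ge0.
- move=> s; rewrite /= in_itv/= andbT => s0.
  by rewrite lee_fin one_sub_expRN_ge0// mulr_ge0 ?subr_ge0// ltW.
- by apply: measurable_one_sub_expRN; exact: measurable_funM.
rewrite fineK ?exponent_fin_num//; apply: eq_integral => s /set_mem.
rewrite /= in_itv/= andbT => s0.
have zs0 : (0 <= z * s)%R by rewrite mulr_ge0// ltW.
have E : \sum_(j <oo) ((z * s) ^+ j.+1 / j.+1`!%:R)%:E = (expR (z * s) - 1)%:E.
  have := exp_series zs0; rewrite nneseries_recl1.
    rewrite expr0 fact0 divr1 => /(congr1 (fun x => x - 1)).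
    by rewrite [X in X - _]addeC addeK.
  by move=> j; rewrite lee_fin mulr_ge0 ?invr_ge0// exprn_ge0.
under eq_eseriesr do rewrite mulrC EFinM.
rewrite nneseriesZl; last by move=> j _; rewrite lee_fin mulr_ge0 ?invr_ge0// exprn_ge0.
rewrite E -EFinM -EFinD; congr _%:E.
rewrite mulrBr mulr1 -expRD (_ : - s + z * s = - ((1 - z) * s))%R.
  by rewrite [LHS]addrC addrA subrK.
by rewrite mulrBl mul1r opprB addrC.
Qed.

End jump_distribution.

(** * Generating function of the compound Poisson process *)

Section compound_poisson.
Local Open Scope ereal_scope.
Context {R : realType} {d} {T : measurableType d}.
Context {dS} {S : measurableType dS} (P : probability S R).
Variables (rho : {measure set R -> \bar R}) (G0 : {finite_measure set T -> \bar R}).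
Hypothesis rho_neg : rho `]-oo, 0%R]%classic = 0.
Hypothesis rho_neq0 : rho setT != 0.
Hypothesis rho_fin : exponent rho < +oo.
Hypothesis G0_gt0 : 0 < G0 setT.
Variables (l : {mfun S >-> nat}) (n : nat -> {mfun S >-> nat})
  (w : nat -> {mfun S >-> T}).
Hypothesis Y_data : compound_data P rho G0 l n w.

Let mfun_fiber (f : {mfun S >-> nat}) j : measurable [set x | f x = j].
Proof.
rewrite -[X in measurable X]setTI.
exact: (measurable_funPT f measurableT [set j]).
Qed.

Lemma compoundE x A : compound l n w x A =
  marked_points (R := R) (fun y => `I_(l y)) w n x A.
Proof.
rewrite /compound /marked_points esum_fset//; last by move=> k _; rewrite mule_ge0.
exact: (@fsbig_ord _ _ _ (l x) (fun k => (n k x)%:R%:E * \d_(w k x) A)).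
Qed.

Lemma measurable_l_gt k : measurable [set x | `I_(l x) k].
Proof.
rewrite -[X in measurable X]setTI.
exact: (measurable_funPT l measurableT [set j | (k < j)%N]).
Qed.

Lemma compound_count x A : exists j : nat, compound (R := R) l n w x A = j%:R%:E.
Proof.
exists (\sum_(k < l x) n k x * (w k x \in A))%N.
by rewrite natr_sum -sumEFin; apply: eq_bigr => k _; rewrite natrM EFinM diracE.
Qed.

(** The data prescribe the masses at j >= 1. They sum to 1, by [jump_gen_fun] at z = 1 and psi(0) =
    0, so no mass is left at 0. *)
Let n_prob k j : P (n k @^-1` [set j]) = (jump_prob rho j)%:E.
Proof.
have [_ nP _ _] := Y_data.
case: j => [|j]; last exact: nP.
have total : \sum_(j <oo) P (n k @^-1` [set j]) = 1.
  rewrite -(@probability_setT _ _ _ P) -measure_semi_bigcup//.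
  - by congr (P _); apply/seteqP; split => // x _; exists (n k x).
  - by move=> j; exact: mfun_fiber.
  - by move=> i j _ _ [x [/= <- <-]].
  - by apply: bigcup_measurable => j _; exact: mfun_fiber.
have psi0 : laplace_exponent rho (1 - 1)%R = 0.
  rewrite subrr; apply: integral0_eq => s _.
  by rewrite mul0r oppr0 expR0 subrr.
have z1 : (0 <= (1 : R) <= 1)%R by rewrite ler01 lexx.
have := jump_gen_fun rho_neg rho_neq0 rho_fin z1.
rewrite psi0 subr0 divff ?gt_eqF ?exponent_gt0//.
rewrite nneseries_recl1; last first.
  by move=> j; rewrite mule_ge0// lee_fin ?expr1n// jump_prob_ge0.
rewrite mule0 add0e => tail; move: total; rewrite nneseries_recl1//.
rewrite (_ : \sum_(j <oo) P (n k @^-1` [set j.+1]) = 1).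
  by move/(congr1 (fun x => x - 1)); rewrite addeK// subee.
rewrite -[RHS]tail; apply: eq_eseriesr => j _.
by rewrite expr1n mul1e nP.
Qed.

Variables (M : nat) (tau : T -> nat) (z : nat -> R).
Hypothesis lab : labelling M tau.
Hypothesis z01 : forall t, (0 < z t < 1)%R.

Let B t := tau @^-1` [set t].

Local Notation e := (fine (exponent rho)).
Local Notation Gamma := (fine (G0 setT)).

(** The number phi of the overview. *)
Let jump_label_gen : R :=
  (\sum_(t < M) fine (G0 (B t)) / Gamma * ((e - fine (laplace_exponent rho (1 - z t))) / e))%R.

Let esum_jump_label k :
  \esum_(i in [set: nat * nat]) ((z i.1 ^+ i.2)%:E *
    (P (n k @^-1` [set i.2]) * P (w k @^-1` B i.1))) = jump_label_gen%:E.
Proof.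
have w_prob t : P (w k @^-1` B t) = (fine (G0 (B t)) / Gamma)%:E.
  have [_ _ wP _] := Y_data.
  by rewrite (wP k _ (lab.1 t)) EFinM fineK//; exact: (fin_num_measure G0 _ (lab.1 t)).
have e0 := exponent_gt0 rho_neg rho_neq0 rho_fin.
have z01' t : (0 <= z t <= 1)%R by case/andP: (z01 t) => /ltW -> /ltW ->.
have z0 t : (0 <= z t)%R by case/andP: (z01' t).
have inner t : \esum_(j in [set: nat]) ((z t ^+ j)%:E *
    (P (n k @^-1` [set j]) * P (w k @^-1` B t))) =
    (fine (G0 (B t)) / Gamma *
      ((e - fine (laplace_exponent rho (1 - z t))) / e))%:E.
  rewrite EFinM -(jump_gen_fun rho_neg rho_neq0 rho_fin (z01' t)) -w_prob.
  rewrite nneseries_esumT; last first.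
    by move=> j; rewrite mule_ge0// lee_fin ?exprn_ge0// jump_prob_ge0.
  rewrite -esumZl//; last first.
    by move=> j; rewrite mule_ge0// lee_fin ?exprn_ge0// jump_prob_ge0.
  by apply: eq_esum => j _; rewrite n_prob muleA muleC.
rewrite (_ : [set: nat * nat] = [set: nat] `*`` (fun=> [set: nat])); last first.
  by apply/seteqP; split.
rewrite -(@esum_esum R nat nat setT (fun=> setT) (fun t j =>
  (z t ^+ j)%:E * (P (n k @^-1` [set j]) * P (w k @^-1` B t)))); last first.
  by move=> t j _ _; rewrite mule_ge0 ?lee_fin ?exprn_ge0// mule_ge0.
under eq_esum do rewrite inner.
rewrite -nneseries_esumT; last first.
  move=> t; rewrite -inner; apply: esum_ge0 => j _.
  by rewrite mule_ge0 ?lee_fin ?exprn_ge0// mule_ge0.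
rewrite (nneseries_split 0 M); last first.
  move=> t _; rewrite -inner; apply: esum_ge0 => j _.
  by rewrite mule_ge0 ?lee_fin ?exprn_ge0// mule_ge0.
rewrite [X in _ + X]eseries0 ?adde0.
  by rewrite add0n big_mkord sumEFin.
(* Labels stay below M, so the remaining cells are empty. *)
move=> t Mt _; rewrite (_ : B t = set0) ?measure0/= ?mul0r//.
apply/seteqP; split => // y /= yt; have := lab.2 y.
by rewrite yt ltnNge -[(M <= t)%N]/(0 + M <= t)%N Mt.
Qed.

Let z0 t : (0 <= z t)%R.
Proof. by case/andP: (z01 t) => /ltW. Qed.

Let jump_label_gen_ge0 : (0 <= jump_label_gen)%R.
Proof.
rewrite -lee_fin -(esum_jump_label 0); apply: esum_ge0 => i _.
by rewrite mule_ge0 ?lee_fin ?exprn_ge0// mule_ge0.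
Qed.

Let measurable_label_count k (i : nat * nat) :
  measurable [set x | Some (tau (w k x), n k x) = Some i].
Proof.
rewrite (_ : [set x | _] = (w k @^-1` B i.1) `&` [set x | n k x = i.2]).
  apply: measurableI; last exact: mfun_fiber.
  rewrite -[X in measurable X]setTI.
  exact: (measurable_funPT (w k) measurableT _ (lab.1 i.1)).
by apply/seteqP; split => x /=; case: i => t j /=; [case|move=> [-> ->]].
Qed.

(** The indicator of l = L serves as weight on both sides of [integral_prod_mixture]; by
    independence each pair of label and jump contributes one factor phi. *)
Let integral_compound_fixed L :
  \int[P]_x ((Some (l x) == Some L)%:R%:E *
     \prod_(k < L) (z (tau (w k x)) ^+ n k x)%:E) =
  P (l @^-1` [set L]) * (jump_label_gen ^+ L)%:E.
Proof.
have [_ _ _ indep] := Y_data.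
have mL : measurable (l @^-1` [set L]) := mfun_fiber l L.
pose W x : \bar R := (\1_(l @^-1` [set L]) x)%:E.
have mW : measurable_fun setT W.
  by apply/measurable_EFinP; exact: measurable_indic.
have W0 x : 0 <= W x by rewrite lee_fin.
have intW a : 0 <= a -> \int[P]_x (W x * a) = P (l @^-1` [set L]) * a.
  move=> a0; under eq_integral do rewrite muleC.
  by rewrite ge0_integralZl// integral_indic// setIT muleC.
transitivity (\int[P]_x (W x * \prod_(k < L)
    oapp (fun i : nat * nat => (z i.1 ^+ i.2)%:E) 0 (Some (tau (w k x), n k x)))).
  apply: eq_integral => x _; congr (_ * _); rewrite /W indicE.
  congr (nat_of_bool _)%:R%:E; apply/eqP/idP; rewrite inE /=; first by case.
  by move=> ->.
rewrite (@integral_prod_mixture _ _ _ _ _ (0%N, 0%N) L W W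
  (fun k x => Some (tau (w k x), n k x))
  (fun k i _ => P (n k @^-1` [set i.2]) * P (w k @^-1` B i.1))
  (fun k i => (z i.1 ^+ i.2)%:E))//.
- rewrite -intW ?lee_fin ?exprn_ge0//; apply: eq_integral => x _; congr (_ * _).
  under eq_bigr do rewrite esum_jump_label.
  by rewrite prodEFin prodr_const card_ord.
- by move=> k i _; rewrite mule_ge0.
- by move=> k i; rewrite lee_fin exprn_ge0.
move=> c; rewrite (@integral_prod_delta _ _ _ _ P L _
  (fun k x => Some (tau (w k x), n k x)) c mL measurable_label_count).
rewrite intW; last by apply: prode_ge0 => k _; rewrite mule_ge0.
rewrite -(indep L [set L] (fun k => [set (c k).2]) (fun k => B (c k).1)); last first.
  by move=> k; exact: lab.1.
congr (P (_ `&` _)); apply/seteqP; split => x /= h k kL; have := h k kL.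
  by move=> [<-].
by case: (c k) => t j /= [-> <-].
Qed.

Lemma compound_gen_fun :
  \int[P]_x \prod_(t < M) pow (z t) (to_count (compound (R := R) l n w x (B t))) =
  expeR (- \sum_(t < M) laplace_exponent rho (1 - z t) * G0 (B t)).
Proof.
have [lP _ _ _] := Y_data.
pose h L x : \bar R := \prod_(k < L) (z (tau (w k x)) ^+ n k x)%:E.
have h0 L x : 0 <= h L x by apply: prode_ge0 => k _; rewrite lee_fin exprn_ge0.
(* The random number of factors is resolved by a sum over the values L of l. *)
transitivity (\int[P]_x \esum_(L in [set: nat]) ((Some (l x) == Some L)%:R%:E * h L x)).
  apply: eq_integral => x _.
  under eq_bigr do rewrite compoundE.
  rewrite (prod_pow_marked_points _ _ _ _ lab z01).
  under [RHS]eq_esum do rewrite muleC.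
  rewrite (esum_delta (g := fun L => h L x))//=.
  have lnz t : (0 <= - ln (z t))%R.
    by rewrite oppr_ge0 ln_le0// ltW//; case/andP: (z01 t).
  rewrite esum_fset//; last by move=> k _; rewrite lee_fin mulr_ge0.
  rewrite -(@fsbig_ord _ _ _ (l x) (fun k => (- ln (z (tau (w k x))) * (n k x)%:R)%:E)).
  rewrite (expeRN_sum (l x) (u := fun k => (- ln (z (tau (w k x))) * (n k x)%:R)%:E)); last first.
    by move=> k; rewrite lee_fin mulr_ge0.
  apply: eq_bigr => k _ /=; rewrite mulNr opprK mulrC expRM_natl lnK// posrE.
  by case/andP: (z01 (tau (w k x))).
rewrite ge0_integral_esum; last 2 first.
- move=> L; apply: emeasurable_funM.
    apply: measurable_fun_option_eq.
    rewrite (_ : [set x | _] = [set x | l x = L]); first exact: mfun_fiber.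
    by apply/seteqP; split => x /=; [case|move=> ->].
  apply: (@emeasurable_prod _ _ _ L
    (fun k x => (z (tau (w k x)) ^+ n k x)%:E)) => k.
  apply: (@measurable_fun_oapp _ _ _ _ (fun i : nat * nat => (z i.1 ^+ i.2)%:E)
    (fun x => Some (tau (w k x), n k x))) => //.
  by move=> i; rewrite lee_fin exprn_ge0.
- by move=> L x; rewrite mule_ge0.
under eq_esum do rewrite integral_compound_fixed lP muleC.
have e0 := exponent_gt0 rho_neg rho_neq0 rho_fin.
have Lam : fine (G0 setT * exponent rho) = (Gamma * e)%R.
  rewrite fineM//; first exact: fin_num_measure.
  exact: exponent_fin_num.
have Gamma0 : (0 < Gamma)%R.
  by rewrite fine_gt0// G0_gt0/= -ge0_fin_numE// fin_num_measure.
rewrite -nneseries_esumT; last first.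
  by move=> L; rewrite mule_ge0// lee_fin ?exprn_ge0// Po_ge0// Lam mulr_ge0// ltW.
rewrite Po_gen_fun// Lam; last by rewrite mulr_ge0// ltW.
have z1 t : (0 <= 1 - z t <= 1)%R.
  by rewrite subr_ge0 gerBl z0 andbT; case/andP: (z01 t) => _ /ltW.
have -> : \sum_(t < M) laplace_exponent rho (1 - z t) * G0 (B t) =
    (\sum_(t < M) fine (laplace_exponent rho (1 - z t)) * fine (G0 (B t)))%:E.
  rewrite -sumEFin; apply: eq_bigr => t _.
  rewrite EFinM (fineK (laplace_exponent_fin_num rho_fin (z1 t))) fineK//.
  exact: (fin_num_measure G0 _ (lab.1 t)).
congr (expR (- _))%:E.
(* With the total mass split over the cells, (1 - phi) Gamma e becomes sum_t G0(B t) (e - (e - psi(1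
   - z t))), and e cancels term by term. *)
have GammaE : Gamma = (\sum_(t < M) fine (G0 (B t)))%R.
  have addG : additive_set_fun G0.
    split; first exact: measure0.
    by move=> A A' mA mA' AA'; exact: measureU.
  rewrite (additive_labelling addG lab measurableT) -sum_fine.
    by apply: eq_bigr => t _; rewrite setTI.
  by move=> t _; rewrite setTI; exact: (fin_num_measure G0 _ (lab.1 t)).
rewrite mulrBl mul1r {1}GammaE /jump_label_gen !mulr_suml -sumrB.
apply: eq_bigr => t _.
by field; rewrite !gt_eqF.
Qed.

End compound_poisson.

Theorem theorem1 (R : realType) (Omega : completeMetricType R)
    (Omega_separable : separable Omega)
    (G0 : {finite_measure set (borel Omega) -> \bar R})
    (G0_gt0 : (0 < G0 setT)%E)
    (* rho is a nonzero measure on (0, +oo), seen as a measure on R *)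
    (rho : {measure set R -> \bar R})
    (rho_pos : rho `]-oo, 0]%classic = 0%E)
    (rho_neq0 : rho setT != 0%E)
    (rho_fin : (exponent rho < +oo)%E)
    (d : measure_display) (S : measurableType d) (P : probability S R)
    (K : S -> set nat) (r : nat -> {mfun S >-> R})
    (w : nat -> {mfun S >-> borel Omega})
    (G_crm : points_of_crm P K r w rho G0)
    (d' : measure_display) (S' : measurableType d') (P' : probability S' R)
    (l : {mfun S' >-> nat}) (n' : nat -> {mfun S' >-> nat})
    (w' : nat -> {mfun S' >-> borel Omega})
    (Y_data : compound_data P' rho G0 l n' w') :
  (forall X : R.-ker S ~> borel Omega,
     mixed_poisson P (weighted_points K r w) (fun x A => X x A) ->
     same_law P (fun x A => X x A) P' (compound l n' w'))
  /\
  (forall n : nat -> {mfun S >-> nat},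
     poisson_marks P K r w n ->
     same_law P (marked_points K w n) P' (compound l n' w')).
Proof.
have rho_neg : rho `]-oo, 0%R]%classic = 0%E by [].
have Y_gen := compound_gen_fun rho_neg rho_neq0 rho_fin G0_gt0 Y_data.
have Y_add x : additive_set_fun (compound (R := R) l n' w' x).
  rewrite (_ : compound _ _ _ x = marked_points (R := R) (fun y => `I_(l y)) w' n' x).
    exact: additive_marked_points.
  by apply/funext => A; exact: compoundE.
have mY A : measurable A ->
    measurable_fun setT (fun x => compound (R := R) l n' w' x A).
  move=> mA; rewrite (_ : (fun x => _) =
      fun x => marked_points (R := R) (fun y => `I_(l y)) w' n' x A).
    by apply: measurable_marked_points => //; exact: measurable_l_gt.
  by apply/funext => x; exact: compoundE.
have [mK r_gt0 prm] := G_crm.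
(* The compound process takes the second place, the one where counts must be finite. *)
split=> [X X_mp|n n_marks]; apply: same_law_gen_fun => //.
- by move=> A mA; exact: measurable_kernel.
- move=> x; split; first exact: measure0.
  by move=> A A' mA mA' AA'; exact: measureU.
- by move=> x A _; exact: compound_count.
- move=> M tau z lab z01; rewrite (Y_gen M tau z lab z01).
  by apply: (mixed_poisson_gen_fun rho_neg rho_fin G_crm _ X_mp lab z01) => A mA;
    exact: measurable_kernel.
- by move=> A mA; exact: measurable_marked_points.
- by move=> x; exact: additive_marked_points.
- by move=> x A _; exact: compound_count.
- move=> M tau z lab z01; rewrite (Y_gen M tau z lab z01).
  rewrite (poisson_marks_gen_fun mK r_gt0 n_marks lab z01).
  apply: (crm_laplace rho_neg rho_fin G_crm lab (c := fun t => 1 - z t)) => t.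
  by rewrite subr_ge0; case/andP: (z01 t) => _ /ltW.
Qed.
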